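(* In the spatiotemporal E-GARCH model, assume $\mathbf{I}-\lambda_0\mathbf{W}_2$ is invertible, $\varrho(\lambda_1\mathbf{S})<1$ and $\varrho(\lambda_0\mathbf{W}_2)<1$, and let $\{\boldsymbol{\varepsilon}_t\}$ be i.i.d. $N(\mathbf{0},\mathbf{I}_n)$. Then the strictly stationary solution $\boldsymbol{Y}_t=\boldsymbol{\varepsilon}_t\odot\exp\big(\tfrac12\sum_{v\ge0}\lambda_1^v\mathbf{S}^v\boldsymbol{\Delta}_{t-v}\big)$ has finite moments of all orders and is weakly stationary. Writing $\mathbf{M}=\rho_0\lambda_1\mathbf{S}\mathbf{W}_1+\rho_1\mathbf{I}$ and $\mathbf{A}=((1-\lambda_1)\mathbf{I}-\lambda_0\mathbf{W}_2)^{-1}$, for all $t$ and $i,j\in\{1,\dots,n\}$ (all infinite products converging): $$E(Y_t(\boldsymbol{s}_i))=\exp\big(\tfrac12\boldsymbol{e}_i'\mathbf{A}\boldsymbol{\alpha}_1\big)\,E\Big(\varepsilon_1(\boldsymbol{s}_i)\exp\big(\tfrac12\rho_0\boldsymbol{e}_i'\mathbf{S}\mathbf{W}_1g(\boldsymbol{\varepsilon}_1)\big)\Big)\prod_{v=1}^{\infty}E\Big(\exp\big(\tfrac12\lambda_1^{v-1}\boldsymbol{e}_i'\mathbf{S}^{v}\mathbf{M}g(\boldsymbol{\varepsilon}_1)\big)\Big),$$ $$E(Y_t(\boldsymbol{s}_i)^2)=\exp\big(\boldsymbol{e}_i'\mathbf{A}\boldsymbol{\alpha}_1\big)\,E\Big(\varepsilon_1(\boldsymbol{s}_i)^2\exp\big(\rho_0\boldsymbol{e}_i'\mathbf{S}\mathbf{W}_1g(\boldsymbol{\varepsilon}_1)\big)\Big)\prod_{v=1}^{\infty}E\Big(\exp\big(\lambda_1^{v-1}\boldsymbol{e}_i'\mathbf{S}^{v}\mathbf{M}g(\boldsymbol{\varepsilon}_1)\big)\Big),$$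 $$E(Y_t(\boldsymbol{s}_i)Y_t(\boldsymbol{s}_j))=\exp\big(\tfrac12(\boldsymbol{e}_i+\boldsymbol{e}_j)'\mathbf{A}\boldsymbol{\alpha}_1\big)\,E\Big(\varepsilon_1(\boldsymbol{s}_i)\varepsilon_1(\boldsymbol{s}_j)\exp\big(\tfrac12\rho_0(\boldsymbol{e}_i+\boldsymbol{e}_j)'\mathbf{S}\mathbf{W}_1g(\boldsymbol{\varepsilon}_1)\big)\Big)\prod_{v=1}^{\infty}E\Big(\exp\big(\tfrac12\lambda_1^{v-1}(\boldsymbol{e}_i+\boldsymbol{e}_j)'\mathbf{S}^{v}\mathbf{M}g(\boldsymbol{\varepsilon}_1)\big)\Big).$$ None of these quantities depends on $t$.
   Context: Fix $n\ge1$ and known deterministic real $n\times n$ matrices $\mathbf{W}_1,\mathbf{W}_2$. Parameters: $\boldsymbol{\alpha}_1\in\mathbb{R}^n$, $\rho_0,\rho_1,\lambda_0,\lambda_1,\Theta\in\mathbb{R}$, $\xi\ge0$ (standing assumption $|\Theta|<\xi$). Componentwise $g(\boldsymbol{\varepsilon}_t)=\Theta\boldsymbol{\varepsilon}_t+\xi(|\boldsymbol{\varepsilon}_t|-E|\boldsymbol{\varepsilon}_t|)$. Model: $Y_t(\boldsymbol{s}_i)=\sqrt{h_t(\boldsymbol{s}_i)}\,\varepsilon_t(\boldsymbol{s}_i)$ with $\ln\boldsymbol{h}_t=\boldsymbol{\alpha}_1+\rho_0\mathbf{W}_1g(\boldsymbol{\varepsilon}_t)+\rho_1 g(\boldsymbol{\varepsilon}_{t-1})+\lambda_0\mathbf{W}_2\ln\boldsymbol{h}_t+\lambda_1\ln\boldsymbol{h}_{t-1}$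 (componentwise $\ln$). $\mathbf{S}=(\mathbf{I}-\lambda_0\mathbf{W}_2)^{-1}$, $\boldsymbol{\Delta}_t=\mathbf{S}(\boldsymbol{\alpha}_1+\rho_0\mathbf{W}_1g(\boldsymbol{\varepsilon}_t)+\rho_1g(\boldsymbol{\varepsilon}_{t-1}))$. $\varrho(\cdot)$ is spectral radius, $\odot$ Hadamard product, $\boldsymbol{e}_i$ the $i$-th standard unit vector. *)

(* Defs.v *)
From HB Require Import structures.
From mathcomp Require Import all_boot all_order all_algebra.
From mathcomp Require Import all_classical all_reals all_analysis.
From mathcomp Require Import complex.

Set Implicit Arguments.
Unset Strict Implicit.
Unset Printing Implicit Defensive.

Import Order.TTheory GRing.Theory Num.Theory.
Import numFieldNormedType.Exports.
Local Open Scope classical_set_scope.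
Local Open Scope ring_scope.

Section Defs.
Context {R : realType}.

Definition cplx_of (x : R) : complex.complex R := complex.Complex x 0.

Definition spectral_radius (n : nat) (A : 'M[R]_n) : R :=
  sup [set complex.ComplexField.Normc.normc z | z in
        [set z : complex.complex R | eigenvalue (map_mx cplx_of A) z]].

Definition unitv (n : nat) (i : 'I_n) : 'cV[R]_n := delta_mx i 0.

Definition absv (n : nat) (x : 'cV[R]_n) : 'cV[R]_n := map_mx Num.norm x.

(** g(e) = Theta e + xi (|e| - E|e|), where m is the vector E|e| *)
Definition gfun (n : nat) (Theta xi : R) (m e : 'cV[R]_n) : 'cV[R]_n :=
  Theta *: e + xi *: (absv e - m).

Definition series_value (u : nat -> R) : R :=
  if `[< cvgn (series u) >] then limn (series u) else 0.

End Defs.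

Section Prob.
Context {d : measure_display} {T : measurableType d} {R : realType}.
Variable P : probability T R.

Definition mutually_independent (I : eqType) (X : I -> T -> R) : Prop :=
  (forall k, measurable_fun setT (X k)) /\
  forall (s : seq I) (B : I -> set R), uniq s ->
    (forall k, measurable (B k)) ->
    P (\bigcap_(k in [set k | k \in s]) (X k @^-1` B k)) =
    (\prod_(k <- s) P (X k @^-1` B k))%E.

Definition std_normal (X : T -> R) : Prop :=
  measurable_fun setT X /\
  forall B : set R, measurable B -> P (X @^-1` B) = normal_prob 0 1 B.

Definition vec_at (n : nat) (eps : int -> 'I_n -> T -> R) (t : int) (w : T)
  : 'cV[R]_n := \col_(i < n) eps t i w.

Definition Eabs (n : nat) (eps : int -> 'I_n -> T -> R) (t : int) : 'cV[R]_n :=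
  \col_(i < n) fine ('E_P[fun w => `|eps t i w|]).

Definition g_at (n : nat) (Theta xi : R) (eps : int -> 'I_n -> T -> R)
  (t : int) (w : T) : 'cV[R]_n :=
  gfun Theta xi (Eabs eps t) (vec_at eps t w).

Definition Delta (n : nat) (S W1 : 'M[R]_n) (alpha1 : 'cV[R]_n)
  (rho0 rho1 Theta xi : R) (eps : int -> 'I_n -> T -> R) (t : int) (w : T)
  : 'cV[R]_n :=
  S *m (alpha1 + rho0 *: (W1 *m g_at Theta xi eps t w)
               + rho1 *: g_at Theta xi eps (t - 1) w).

(** v-th term (lambda1^v S^v Delta_{t-v})_i of the series defining ln h_t(s_i) *)
Definition Yterm (n : nat) (S W1 : 'M[R]_n) (alpha1 : 'cV[R]_n)
  (rho0 rho1 lambda1 Theta xi : R) (eps : int -> 'I_n -> T -> R)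
  (t : int) (i : 'I_n) (w : T) (v : nat) : R :=
  ((lambda1 ^+ v) *: (S ^+ v) *m Delta S W1 alpha1 rho0 rho1 Theta xi eps
        (t - (v : int)) w) i 0.

Definition Ysol (n : nat) (S W1 : 'M[R]_n) (alpha1 : 'cV[R]_n)
  (rho0 rho1 lambda1 Theta xi : R) (eps : int -> 'I_n -> T -> R)
  (t : int) (i : 'I_n) (w : T) : R :=
  eps t i w * expR (2^-1 * series_value
     (Yterm S W1 alpha1 rho0 rho1 lambda1 Theta xi eps t i w)).

Definition weakly_stationary (n : nat) (Y : int -> 'I_n -> T -> R) : Prop :=
  (forall t i, P.-integrable setT (fun w => ((Y t i w) ^+ 2)%:E)) /\
  (forall t i, ('E_P[Y t i] = 'E_P[Y 0%R i])%E) /\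
  (forall (t h : int) i j,
      covariance P (Y (t + h) i) (Y t j) = covariance P (Y h i) (Y 0 j)).

End Prob.

(* Main.v *)
Require Import Defs.
From HB Require Import structures.
From mathcomp Require Import all_boot all_order all_algebra.
From mathcomp Require Import all_classical all_reals all_analysis.
From mathcomp Require Import complex.
From mathcomp Require Import measurable_realfun ring lra.

Import Order.TTheory GRing.Theory Num.Theory.
Import numFieldNormedType.Exports.
Local Open Scope classical_set_scope.
Local Open Scope ring_scope.

(** Since [g] acts componentwise, everything reduces to the independent standard
normal reals [eps t k]. Up to the constant factor [exp (1/2 e_i' A alpha_1)],
[Y_t(s_i)^p] is the almost sure limit of the finite products, over the lags
[u < N] and the components [k], of [x^m exp (c_(u,k) g x)] at
[x = eps (t - u) k], where [m = 0] for [u > 0] and [|c_(u,k)| <= C r^u] with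
[r < 1] because the spectral radius of [lambda1 S] is less than 1. These
products are bounded by [exp (sum_(u,k) b_(u,k) (|eps (t - u) k| + 1))] with
[b] summable; this bound is integrable by monotone convergence, because
[E exp (b (|Z| + 1)) <= exp (K b)] for bounded [b >= 0]. Dominated convergence
turns the product formula for independent variables into the infinite products,
in which [t] no longer occurs. *)

(** ** Powers of a matrix of spectral radius less than 1 *)

Section MatrixPowers.
Context {R : realType}.
Notation normc := complex.ComplexField.Normc.normc.

(** The terms of the series for [ln h_t] are not independent: [Delta_(t-v)] and [Delta_(t-v-1)]
    share the innovation at time [t-v-1]. Regrouping by innovation produces the independent factors
    and the matrix [M], at the cost of a boundary term that has to vanish almost surely. The
    constant part sums to [A alpha_1]; that the matrix defining [A] is invertible comes out of the
    convergence of this geometric series. The products themselves can change sign, so monotone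
    convergence serves only for their envelope. The bound [exp (K b)] on the expectation of a factor
    of the envelope must tend to 1 with [b], or the product of the bounds over the lags would
    diverge. Positivity of the limiting products is a separate matter: each limit is the expectation
    of a positive random variable. A single moment, [E (Y_(t+h)(s_i)^p Y_t(s_j)^q)], serves all
    claims: [h = 0] gives the three formulas, [p = q = 1] with arbitrary [h] the covariances,
    [q = 0] the finite moments. *)

Lemma first_order_recurrence_bound (z : complex.complex R)
    (a : nat -> complex.complex R) (C r : R) :
  normc z < r -> (forall v, normc (a v.+1 - z * a v) <= C * r ^+ v) ->
  exists C', forall v, normc (a v) <= C' * r ^+ v.
Proof.
move=> zr ha.
have rz : 0 < r - normc z by rewrite subr_gt0.
(* The second entry is the least [C'] with [C + |z| C' <= C' r], which is what the induction step
   needs; the first covers [v = 0]. *)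
exists (Num.max (normc (a 0)) (C / (r - normc z))).
set C' := Num.max _ _.
have C0 : normc (a 0) <= C' by rewrite le_max lexx.
have C1 : C <= C' * (r - normc z).
  by rewrite -ler_pdivrMr// le_max lexx orbT.
have z0 : 0 <= normc z by case: (z) => x y; rewrite sqrtr_ge0.
have r0 : 0 < r by apply: le_lt_trans zr.
elim=> [|v IH]; first by rewrite expr0 mulr1.
have -> : a v.+1 = (a v.+1 - z * a v) + z * a v by rewrite subrK.
apply: le_trans (le_normcD _ _) _.
rewrite complex.ComplexField.Normc.normcM.
apply: (@le_trans _ _ (C * r ^+ v + normc z * (C' * r ^+ v))).
  by rewrite lerD// ler_wpM2l.
rewrite exprS.
have := exprn_ge0 v (ltW r0); set q := r ^+ v => q0.
have : C * q <= C' * (r - normc z) * q by rewrite ler_wpM2r.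
lra.
Qed.

(* The factors of an annihilating polynomial are removed one at a time: the
   entries of [B ^+ v * Q] satisfy a first-order recurrence with ratio [z] whose
   error term is the entry of [B ^+ v * (B - z) * Q]. *)
Lemma mx_pow_bound_of_annihilator (n : nat) (B : 'M[complex.complex R]_n.+1)
    (r : R) (i j : 'I_n.+1) (s : seq (complex.complex R)) :
  (forall z, z \in s -> normc z < r) ->
  (exists C, forall v,
    normc ((B ^+ v * horner_mx B (\prod_(z <- s) ('X - z%:P))) i j)
      <= C * r ^+ v) ->
  exists C, forall v, normc ((B ^+ v) i j) <= C * r ^+ v.
Proof.
elim: s => [|z s IH] hs [C hC].
  exists C => v; have := hC v.
  by rewrite big_nil rmorph1 mulr1.
apply: IH => [y ys|]; first by apply: hs; rewrite inE ys orbT.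
apply: (@first_order_recurrence_bound z _ C) => [|v].
  by apply: hs; rewrite inE eqxx.
suff -> : (B ^+ v.+1 * horner_mx B (\prod_(z <- s) ('X - z%:P))) i j -
  z * (B ^+ v * horner_mx B (\prod_(z <- s) ('X - z%:P))) i j =
  (B ^+ v * horner_mx B (\prod_(z <- (z :: s)) ('X - z%:P))) i j by exact: hC.
rewrite big_cons rmorphM rmorphB /= horner_mx_X horner_mx_C.
set H := horner_mx B (\prod_(y <- s) _).
have -> : (B - z%:M) * H = B * H - z *: H.
  by rewrite mulrBl; congr (_ - _); apply: mul_scalar_mx.
by rewrite exprSr -mulrA mulrBr -scalerAr !mxE.
Qed.

Lemma eigenvalue_le_spectral_radius (n : nat) (B : 'M[R]_n)
    (z : complex.complex R) :
  eigenvalue (map_mx cplx_of B) z -> normc z <= spectral_radius B.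
Proof.
move=> hz; apply: sup_ubound; last by exists z.
have [s hs] := closed_field_poly_normal (char_poly (map_mx cplx_of B)).
(* The supremum bounds its set only if the set is bounded: the eigenvalues are among the finitely
   many roots [s]. *)
exists (\sum_(y <- s) normc y) => _ /= [y hy <-].
have ys : y \in s.
  have : root (char_poly (map_mx cplx_of B)) y by rewrite -eigenvalue_root_char.
  rewrite hs rootZ ?root_prod_XsubC//.
  by rewrite (monicP (char_poly_monic _)) oner_eq0.
rewrite (big_rem y)//= lerDl sumr_ge0// => x _.
by case: x => ? ?; rewrite sqrtr_ge0.
Qed.

(** A rate strictly above the spectral radius absorbs the polynomial growth caused by Jordan blocks.
    The characteristic polynomial splits over the complex numbers and annihilates the matrix by
    Cayley-Hamilton, so the removal of linear factors starts from the zero sequence. *)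
Lemma spectral_radius_mx_pow_bound (n : nat) (B : 'M[R]_n) :
  spectral_radius B < 1 ->
  exists C r, [/\ 0 <= C, 0 < r, r < 1 &
    forall v i j, `|(B ^+ v) i j| <= C * r ^+ v].
Proof.
have half_lt1 : 2^-1 < 1 :> R by rewrite invf_lt1 ?ltr1n.
case: n B => [|n] B hB.
  by exists 0, 2^-1; split => // ? [].
(* The midpoint lies strictly between the spectral radius and 1; the maximum with 1/2 makes [r]
   positive without a lower bound on the supremum. *)
pose r := Num.max 2^-1 ((spectral_radius B + 1) / 2).
have r0 : 0 < r by rewrite lt_max invr_gt0 ltr0n.
have r1 : r < 1.
  by rewrite gt_max half_lt1/= ltr_pdivrMr// mul1r; lra.
have rB : spectral_radius B < r.
  by rewrite lt_max ltr_pdivlMr//; apply/orP; right; lra.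
pose K := map_mx (@cplx_of R) B.
have hK i j : exists C, forall v, normc ((K ^+ v) i j) <= C * r ^+ v.
  have [s hs] := closed_field_poly_normal (char_poly K).
  apply: (@mx_pow_bound_of_annihilator _ _ _ _ _ s) => [z zs|].
    apply: le_lt_trans rB; apply: eigenvalue_le_spectral_radius.
    rewrite eigenvalue_root_char hs rootZ ?root_prod_XsubC//.
    by rewrite (monicP (char_poly_monic _)) oner_eq0.
  exists 0 => v; have := Cayley_Hamilton K.
  rewrite {1}hs (monicP (char_poly_monic _)) scale1r => ->.
  by rewrite mulr0 mxE mul0r; case: (complex.ComplexField.Normc.normc0 R) => ->.
have BK v i j : `|(B ^+ v) i j| = normc ((K ^+ v) i j).
  have -> : K ^+ v = map_mx (@cplx_of R) (B ^+ v).
    by rewrite /K (rmorphXn (map_mx (real_complex R))).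
  by rewrite mxE /= expr0n addr0 sqrtr_sqr.
have /choice[D hD] : forall ij : 'I_n.+1 * 'I_n.+1, exists C, forall v,
   `|(B ^+ v) ij.1 ij.2| <= C * r ^+ v.
  by move=> [i j]; have [C hC] := hK i j; exists C => v; rewrite BK; apply: hC.
have D0 ij : 0 <= D ij.
  by have := hD ij 0%N; rewrite expr0 mulr1; apply: le_trans.
exists (\sum_ij D ij), r; split => // [|v i j]; first exact: sumr_ge0.
apply: le_trans (hD (i, j) v) _; rewrite ler_wpM2r ?exprn_ge0 ?(ltW r0)//.
by rewrite (bigD1 (i, j))//= lerDl sumr_ge0.
Qed.

End MatrixPowers.

(** * Geometric series of matrices and the inverse that they define *)

Section GeometricMatrixSeries.
Context {R : realType} {n : nat}.
Implicit Types (S K Q : 'M[R]_n).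

Lemma mulmx_entry_bound {p : nat} Q (N : 'M[R]_(n, p)) (C : R) i k :
  (forall i j, `|Q i j| <= C) ->
  `|(Q *m N) i k| <= C * \sum_j \sum_l `|N j l|.
Proof.
move=> hQ; rewrite mxE mulr_sumr; apply: le_trans (ler_norm_sum _ _ _) _.
apply: ler_sum => j _; rewrite normrM ler_pM//.
by rewrite (bigD1 k)//= lerDl sumr_ge0.
Qed.

Lemma scalemx_exp (a : R) S v : (a *: S) ^+ v = a ^+ v *: S ^+ v.
Proof.
elim: v => [|v IH]; first by rewrite !expr0 scale1r.
by rewrite !exprS IH -!mulmxE -scalemxAl -scalemxAr scalerA.
Qed.

Lemma sum_geometric_le (r : R) N : 0 < r -> r < 1 ->
  \sum_(0 <= u < N) r ^+ u <= (1 - r)^-1.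
Proof.
move=> r0 r1; have d0 : 0 < 1 - r by rewrite subr_gt0.
have e : (1 - r) * (\sum_(0 <= u < N) r ^+ u) = 1 - r ^+ N.
  elim: N => [|N IH]; first by rewrite big_geq// mulr0 expr0 subrr.
  by rewrite big_nat_recr//= mulrDr IH exprS; ring.
by rewrite -[leRHS]mul1r ler_pdivlMr// mulrC e gerBl exprn_ge0// ltW.
Qed.

Lemma cvg_finite_sum (I : Type) (s : seq I) (u : I -> nat -> R) (l : I -> R) :
  (forall i, u i @ \oo --> l i) ->
  (fun N => \sum_(i <- s) u i N) @ \oo --> \sum_(i <- s) l i.
Proof.
move=> ul; elim: s => [|i s IH].
  by under eq_fun do rewrite big_nil; rewrite big_nil; exact: cvg_cst.
by under eq_fun do rewrite big_cons; rewrite big_cons; exact: cvgD.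
Qed.

Variables (S K : 'M[R]_n) (lambda : R).
Hypothesis SK : S *m K = 1%:M - lambda *: S.
Variables (C r : R).
Hypotheses (r0 : 0 < r) (r1 : r < 1).
Hypothesis Sr : forall v i j, `|((lambda *: S) ^+ v) i j| <= C * r ^+ v.

Lemma cvg_mx_pow0 i j : (fun v => ((lambda *: S) ^+ v) i j) @ \oo --> (0 : R).
Proof.
have h : C * r ^+ v @[v --> \oo] --> (0 : R).
  by apply: cvg_geometric; rewrite ger0_norm// ltW.
have h' : - (C * r ^+ v) @[v --> \oo] --> (0 : R).
  by rewrite -oppr0; exact: cvgN.
apply: squeeze_cvgr h' h; apply: nearW => v.
by rewrite -ler_norml.
Qed.

(** By [SK] the products of the terms with [K] telescope: the partial sums times [K] are
    [1 - (lambda S)^N], which tends to 1. The limit is thus a left inverse, and invertibility of [K]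
    is a result here. *)
Lemma cvg_geometric_mx i j :
  (fun N => (\sum_(0 <= v < N) ((lambda *: S) ^+ v *m S) i j)) @ \oo
     --> (invmx K) i j.
Proof.
set E := fun v => (lambda *: S) ^+ v *m S.
pose D := \sum_j \sum_l `|S j l|.
have ED v k l : `|E v k l| <= C * D * r ^+ v.
  rewrite mulrAC; apply: mulmx_entry_bound => *; exact: Sr.
have cE k l : cvgn (series (fun v => E v k l)).
  apply: normed_cvg; apply: (@series_le_cvg _ _ (fun v => C * D * r ^+ v)) => //.
  - by move=> v /=.
  - by move=> v; apply: le_trans (ED v k l).
  - by move=> v; exact: ED.
  by apply: is_cvg_geometric_series; rewrite ger0_norm// ltW.
pose U : 'M[R]_n := \matrix_(k, l) limn (series (fun v => E v k l)).
have UK : U *m K = 1%:M.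
  apply/matrixP => k l.
  have l1 : (fun N => \sum_m (series (fun v => E v k m) N) * K m l) @ \oo
      --> (U *m K) k l.
    rewrite mxE; apply: cvg_finite_sum => m; apply: cvgMl; rewrite mxE; exact: cE.
  have l2 : (fun N => (1%:M : 'M[R]_n) k l - ((lambda *: S) ^+ N) k l) @ \oo
      --> (1%:M : 'M[R]_n) k l.
    rewrite -[X in _ --> X]subr0; apply: cvgB; first exact: cvg_cst.
    exact: cvg_mx_pow0.
  apply: cvg_unique l1 _ => //; apply: cvg_trans l2.
  apply: near_eq_cvg; apply: nearW => N.
  elim: N => [|N IH].
    rewrite expr0 subrr big1// => m _; by rewrite /series /= big_geq// mul0r.
  transitivity (\sum_m series (fun v => E v k m) N * K m l + (E N *m K) k l).
    have -> : E N *m K = (lambda *: S) ^+ N - (lambda *: S) ^+ N.+1.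
      by rewrite /E -mulmxA SK mulmxBr mulmx1 exprSr.
    have -> : ((lambda *: S) ^+ N - (lambda *: S) ^+ N.+1) k l =
        ((lambda *: S) ^+ N) k l - ((lambda *: S) ^+ N.+1) k l by rewrite !mxE.
    by rewrite -IH addrA subrK.
  rewrite mxE -big_split; apply: eq_bigr => m _ /=.
  by rewrite -mulrDl /series /= big_nat_recr.
have -> : invmx K = U.
  have [Uu Ku] := mulmx1_unit UK.
  by rewrite -[LHS]mul1mx -UK mulmxK.
by rewrite mxE; exact: cE.
Qed.

End GeometricMatrixSeries.

(** ** Products of independent variables *)

Section IndicatorExtension.
Import HBNNSimple.

(** The hypothesis says that the image under [X] of [mu] weighted by [G] is [c nu]; simple functions
    and monotone convergence extend it from sets to functions. It serves twice: for independence,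
    with [G] the product of the other factors, and for the normal law, with [G] its density and [X]
    the identity. *)
Lemma eq_ge0_integral_of_indic (d d' : measure_display) (T : measurableType d)
  (U : measurableType d') (R : realType) (mu : measure T R) (nu : measure U R)
  (X : T -> U) (G : T -> R) (c : R) :
  measurable_fun setT X -> measurable_fun setT G -> (forall w, 0 <= G w) ->
  0 <= c ->
  (forall B, measurable B ->
    (\int[mu]_w (\1_B (X w) * G w)%:E = c%:E * nu B)%E) ->
  forall f : U -> R, measurable_fun setT f -> (forall x, 0 <= f x) ->
  (\int[mu]_w (f (X w) * G w)%:E = c%:E * \int[nu]_x (f x)%:E)%E.
Proof.
move=> mX mG G0 c0 hB f mf f0.
have mfE : measurable_fun setT (EFin \o f) by exact/measurable_EFinP.
have fE0 x : setT x -> (0 <= (EFin \o f) x)%E by rewrite lee_fin.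
pose g := nnsfun_approx measurableT mfE.
have mI (B : set U) : measurable B ->
    measurable_fun setT (fun w => \1_B (X w) * G w : R).
  by move=> mB; apply: measurable_funM => //; apply: measurableT_comp.
have hs (h : {nnsfun U >-> R}) :
  (\int[mu]_w (h (X w) * G w)%:E = c%:E * \int[nu]_x (h x)%:E)%E.
  (* For negative [y] the level set of the nonnegative [h] is empty, so its indicator kills the
     term. *)
  have term_ge0 y w : 0 <= y * (\1_(h @^-1` [set y]) (X w) * G w).
    have [y0|y0] := ltP y 0; last by rewrite !mulr_ge0.
    by rewrite preimage_nnfun0// indic0 mul0r mulr0.
  rewrite integralT_nnsfun sintegralE.
  transitivity (\int[mu]_w (\sum_(y \in range h)
      (y * (\1_(h @^-1` [set y]) (X w) * G w))%:E))%E.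
    apply: eq_integral => w _; rewrite fimfunE mulr_fsuml// -fsumEFin//.
    by apply: eq_fsbigr => y _; rewrite mulrA.
  rewrite ge0_integral_fsum//=; last 2 first.
  - move=> y; apply/measurable_EFinP; apply: measurable_funM => //.
    exact: mI.
  - by move=> y w _; rewrite lee_fin.
  rewrite ge0_mule_fsumr; last first.
    move=> y; have [y0|y0] := ltP y 0; last by rewrite mule_ge0.
    by rewrite preimage_nnfun0// measure0 mule0.
  apply: eq_fsbigr => y _.
  have [y0|y0] := ltP y 0.
    rewrite preimage_nnfun0// measure0 !mule0 integral0_eq// => w _.
    by rewrite indic0 mul0r mulr0.
  under eq_integral do rewrite EFinM.
  rewrite ge0_integralZl_EFin//; last 2 first.
  - by move=> w _; rewrite lee_fin mulr_ge0.
  - by apply/measurable_EFinP; exact: mI.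
  by rewrite hB// muleCA.
have gf x : (g n x)%:E @[n --> \oo] --> (f x)%:E.
  exact: (cvg_nnsfun_approx measurableT mfE fE0 (x := x) I).
have g_nd x : {homo (fun n => g n x) : n m / (n <= m)%N >-> n <= m}.
  by move=> n m nm; have /lefP := nd_nnsfun_approx measurableT mfE nm; apply.
have lim1 : (\int[mu]_w (g n (X w) * G w)%:E)%E @[n --> \oo] -->
    (\int[mu]_w (f (X w) * G w)%:E)%E.
  rewrite (_ : integral _ _ _ =
      (\int[mu]_w limn (fun n => (g n (X w) * G w)%:E))%E); last first.
    apply: eq_integral => w _; apply/esym/cvg_lim => //.
    under eq_fun do rewrite EFinM.
    rewrite EFinM; apply: cvgeZr => //; exact: gf.
  apply: cvg_monotone_convergence => //.
  - move=> n; apply/measurable_EFinP; apply: measurable_funM => //.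
    exact: measurableT_comp.
  - by move=> n w _; rewrite lee_fin mulr_ge0.
  - by move=> w _ n m nm; rewrite lee_fin ler_wpM2r// g_nd.
have lim2 : (\int[nu]_x (g n x)%:E)%E @[n --> \oo] --> (\int[nu]_x (f x)%:E)%E.
  rewrite (_ : integral nu _ _ =
      (\int[nu]_x limn (fun n => (g n x)%:E))%E); last first.
    by apply: eq_integral => x _; apply/esym/cvg_lim => //; exact: gf.
  apply: cvg_monotone_convergence => //.
  - by move=> n; apply/measurable_EFinP.
  - by move=> n x _; rewrite lee_fin.
  - by move=> x _ n m nm; rewrite lee_fin g_nd.
apply: (cvg_unique _ lim1) => //.
rewrite (funext (fun n => hs (g n))).
exact: cvgeZl.
Qed.

End IndicatorExtension.

Section Independence.
Context {d : measure_display} {T : measurableType d} {R : realType}.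
Variable P : probability T R.
Context {I : eqType}.
Variable X : I -> T -> R.
Hypothesis indep : mutually_independent P X.
Variable nu : I -> probability (measurableTypeR R) R.
Hypothesis lawX : forall k B, measurable B -> P (X k @^-1` B) = nu k B.

(* Independence is the case [s1 = [::]]; the induction on [s1] turns one indicator
   at a time into a function. *)
Lemma ge0_expectation_prod_indep (s1 s2 : seq I) (f : I -> R -> R)
    (B : I -> set R) :
  uniq (s1 ++ s2) -> (forall k, measurable_fun setT (f k)) ->
  (forall k x, 0 <= f k x) ->
  (forall k, (nu k).-integrable setT (EFin \o f k)) ->
  (forall k, measurable (B k)) ->
  (\int[P]_w ((\prod_(k <- s1) f k (X k w)) *
     \prod_(k <- s2) \1_(B k) (X k w))%:E
  = (\prod_(k <- s1) \int[nu k]_x (f k x)%:E) * \prod_(k <- s2) nu k (B k))%E.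
Proof.
move=> us mf f0 intf; have mX := indep.1.
elim: s1 s2 us B => [|k s1 IH] s2 us B mB.
  rewrite big_nil mul1e.
  under eq_integral do rewrite big_nil mul1r.
  have -> : (\prod_(k <- s2) nu k (B k) = \prod_(k <- s2) P (X k @^-1` B k))%E.
    by apply: eq_bigr => k _; rewrite lawX.
  rewrite -indep.2// -[X in P X]setIT -integral_indic//; last first.
    apply: fin_bigcap_measurable => [|k _]; first exact: finite_seq.
    by rewrite -[X in measurable X]setTI; apply: mX.
  apply: eq_integral => w _; congr (_%:E); rewrite [RHS]indicE.
  have [h|/existsNP[k /not_implyP[ks nB]]] :=
      pselect (forall k, k \in s2 -> B k (X k w)).
    rewrite mem_set//= big1_seq// => k /andP[_ ks].
    by rewrite indicE mem_set//; apply: h.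
  rewrite memNset/=; last by apply/existsNP; exists k => /(_ ks).
  apply/eqP; rewrite prodf_seq_eq0; apply/hasP; exists k => //=.
  by rewrite indicE memNset.
(* The extension from indicators needs a real factor: integrability of the [f k] and finiteness of
   the probabilities provide it. *)
have [c c0 cE] : exists2 c : R, 0 <= c & c%:E =
   ((\prod_(k <- s1) \int[nu k]_x (f k x)%:E) * \prod_(k <- s2) nu k (B k))%E.
  pose p (x : \bar R) := (0 <= x)%E && (x \is a fin_num).
  have pM x y : p x -> p y -> p (x * y)%E.
    by move=> /andP[x0 xf] /andP[y0 yf]; rewrite /p mule_ge0//= fin_numM.
  have /andP[h0 hf] : p ((\prod_(k <- s1) \int[nu k]_x (f k x)%:E) *
      \prod_(k <- s2) nu k (B k))%E.
    have p1 : p 1%E by rewrite /p lee01.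
    apply: (pM _ _).
      apply: (big_ind p p1 pM) => j _.
      rewrite /p integral_ge0/=; last by move=> x _; rewrite lee_fin.
      exact: (integrable_fin_num _ (intf j)).
    apply: (big_ind p p1 pM) => j _; rewrite /p measure_ge0 fin_num_measure//.
    exact: mB.
  exists (fine ((\prod_(k <- s1) \int[nu k]_x (f k x)%:E) *
      \prod_(k <- s2) nu k (B k))%E); first exact: fine_ge0.
  by rewrite fineK.
have kn : k \notin s1 ++ s2 by move: us => /= /andP[].
transitivity (\int[P]_w (f k (X k w) * ((\prod_(k <- s1) f k (X k w)) *
   \prod_(k <- s2) \1_(B k) (X k w)))%:E)%E.
  by apply: eq_integral => w _; rewrite big_cons mulrA.
pose G w := (\prod_(k <- s1) f k (X k w)) * \prod_(k <- s2) \1_(B k) (X k w).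
have mG : measurable_fun setT G.
  apply: measurable_funM.
    by apply: measurable_prod => j _; apply: measurableT_comp.
  by apply: measurable_prod => j _; apply: measurableT_comp.
have G0 w : 0 <= G w by rewrite mulr_ge0// prodr_ge0.
have hB A : measurable A ->
    (\int[P]_w (\1_A (X k w) * G w)%:E = c%:E * nu k A)%E.
  move=> mA.
  (* Setting [B] to [A] at [k] moves [k] from the functions to the indicators, where the induction
     hypothesis applies; [k] is fresh, so the other sets do not change. *)
  pose B' j := if j == k then A else B j.
  have mB' j : measurable (B' j) by rewrite /B'; case: ifP.
  have us' : uniq (s1 ++ k :: s2).
    by rewrite -(perm_uniq (s1 := k :: s1 ++ s2))// perm_sym
       (perm_catCA s1 [:: k] s2).
  have B'E j : j \in s2 -> B' j = B j.
    move=> js; rewrite /B'; case: eqP => // jk.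
    by rewrite jk mem_cat in js kn *; rewrite js orbT in kn.
  have := IH (k :: s2) us' B' mB'.
  have B'k : B' k = A by rewrite /B' eqxx.
  have -> : (\prod_(j <- k :: s2) nu j (B' j) =
      nu k A * \prod_(j <- s2) nu j (B j))%E.
    rewrite big_cons B'k; congr (_ * _)%E.
    by apply: eq_big_seq => j js; rewrite B'E.
  rewrite muleCA -cE => h; rewrite muleC -h; apply: eq_integral => w _.
  rewrite big_cons B'k mulrCA; congr (_ * (_ * _))%:E.
  by apply: eq_big_seq => j js; rewrite B'E.
rewrite (@eq_ge0_integral_of_indic _ _ _ _ _ P (nu k) (X k) G c
  (mX k) mG G0 c0 hB (f k) (mf k) (f0 k)).
by rewrite cE big_cons muleC muleA.
Qed.

Lemma integral_EFin_Rintegral {d'} {U : measurableType d'}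
    {mu : measure U R} {f : U -> R} :
  mu.-integrable setT (EFin \o f) ->
  (\int[mu]_x (f x)%:E)%E = (\int[mu]_x f x)%:E.
Proof. by move=> fi; rewrite /Rintegral fineK//; apply: integrable_fin_num. Qed.

Lemma ge0_Rintegral_prod_indep (s : seq I) (f : I -> R -> R) :
  uniq s -> (forall k, (nu k).-integrable setT (EFin \o f k)) ->
  (forall k x, 0 <= f k x) ->
  P.-integrable setT (fun w => (\prod_(k <- s) f k (X k w))%:E) /\
  \int[P]_w (\prod_(k <- s) f k (X k w)) = \prod_(k <- s) \int[nu k]_x f k x.
Proof.
move=> us intf f0.
have mf k : measurable_fun setT (f k).
  by apply/measurable_EFinP; apply: measurable_int (intf k).
have := @ge0_expectation_prod_indep s [::] f (fun=> setT).
rewrite cats0 big_nil mule1 => /(_ us mf f0 intf (fun=> measurableT)).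
under eq_integral do rewrite big_nil mulr1.
have -> : (\prod_(k <- s) \int[nu k]_x (f k x)%:E =
    (\prod_(k <- s) (\int[nu k]_x f k x)%R)%:E)%E.
  rewrite -prodEFin; apply: eq_bigr => k _.
  exact: integral_EFin_Rintegral (intf k).
move=> h; split; last by rewrite /Rintegral h.
apply/integrableP; split.
  apply/measurable_EFinP/measurable_prod => k _.
  by apply: measurableT_comp => //; exact: indep.1.
under eq_integral do rewrite gee0_abs ?lee_fin ?prodr_ge0//.
by rewrite h ltry.
Qed.

(** Integrability follows from the nonnegative case applied to absolute values. For the value, [s2]
    collects the indices whose functions are already nonnegative: each function of [s1] is split
    into positive and negative part, both of which may join [s2], and linearity recombines them. *)
Lemma Rintegral_prod_indep (s : seq I) (f : I -> R -> R) :
  uniq s -> (forall k, (nu k).-integrable setT (EFin \o f k)) ->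
  P.-integrable setT (fun w => (\prod_(k <- s) f k (X k w))%:E) /\
  \int[P]_w (\prod_(k <- s) f k (X k w)) = \prod_(k <- s) \int[nu k]_x f k x.
Proof.
move=> us intf.
have intP (r : seq I) (h : I -> R -> R) : uniq r ->
    (forall k, (nu k).-integrable setT (EFin \o h k)) ->
    P.-integrable setT (fun w => (\prod_(k <- r) h k (X k w))%:E).
  move=> ur inth.
  have [hi _] := @ge0_Rintegral_prod_indep r (fun k x => `|h k x|) ur
    (fun k => integrable_norm (inth k)) (fun k x => normr_ge0 _).
  apply: le_integrable hi => //.
    apply/measurable_EFinP/measurable_prod => k _.
    apply: measurableT_comp; last exact: indep.1.
    by apply/measurable_EFinP; apply: measurable_int (inth k).
  by move=> w _; rewrite /= -normr_prod normr_id.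
split; first exact: intP.
suff H (s1 s2 : seq I) (g : I -> R -> R) : uniq (s1 ++ s2) ->
    (forall k, (nu k).-integrable setT (EFin \o g k)) ->
    (forall k x, k \in s2 -> 0 <= g k x) ->
    \int[P]_w (\prod_(k <- s1 ++ s2) g k (X k w)) =
    \prod_(k <- s1 ++ s2) \int[nu k]_x g k x.
  by have := H s [::] f; rewrite cats0; apply.
elim: s1 s2 g {us intf} => [|k s1 IH] s2 g us intg g0.
  have [_ h] := @ge0_Rintegral_prod_indep s2 (fun k x => `|g k x|) us
    (fun k => integrable_norm (intg k)) (fun k x => normr_ge0 _).
  have gE k : k \in s2 -> (fun x => `|g k x|) = g k.
    by move=> ks; apply/funext => x; rewrite ger0_norm// g0.
  rewrite -[LHS](_ : \int[P]_w (\prod_(k <- s2) `|g k (X k w)|) = _).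
    by rewrite h; apply: eq_big_seq => k ks; rewrite gE.
  apply: eq_Rintegral => w _; apply: eq_big_seq => k ks.
  by rewrite ger0_norm// g0.
pose upd (h : R -> R) j := if j == k then h else g j.
have kn : k \notin s1 ++ s2 by move: us => /= /andP[].
have us' : uniq (s1 ++ k :: s2).
  by rewrite -(perm_uniq (s1 := k :: s1 ++ s2))// perm_sym
     (perm_catCA s1 [:: k] s2).
have step (h : R -> R) : (nu k).-integrable setT (EFin \o h) ->
    (forall x, 0 <= h x) ->
    P.-integrable setT (fun w =>
      (h (X k w) * \prod_(j <- s1 ++ s2) g j (X j w))%:E) /\
    \int[P]_w (h (X k w) * \prod_(j <- s1 ++ s2) g j (X j w)) =
    (\int[nu k]_x h x) * \prod_(j <- s1 ++ s2) \int[nu j]_x g j x.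
  move=> inth h0.
  have intu j : (nu j).-integrable setT (EFin \o upd h j).
    by rewrite /upd; case: eqP => // ->.
  have updE j : j \in s1 ++ s2 -> upd h j = g j.
    by rewrite /upd; case: eqP => // -> jn; rewrite jn in kn.
  have updk : upd h k = h by rewrite /upd eqxx.
  have pE w : \prod_(j <- s1 ++ k :: s2) upd h j (X j w) =
      h (X k w) * \prod_(j <- s1 ++ s2) g j (X j w).
    rewrite (perm_big (k :: s1 ++ s2)) ?(perm_catCA s1 [:: k] s2)//=.
    rewrite big_cons updk; congr (_ * _).
    by apply: eq_big_seq => j js; rewrite updE.
  split.
    have := intP _ _ us' intu.
    by under [X in _.-integrable _ X]funext do rewrite pE.
  under eq_Rintegral do rewrite -pE.
  rewrite (IH (k :: s2) (upd h) us' intu); last first.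
    move=> j x; rewrite inE /upd; case: eqP => // _ /=; exact: g0.
  rewrite (perm_big (k :: s1 ++ s2)) ?(perm_catCA s1 [:: k] s2)//=.
  rewrite big_cons updk; congr (_ * _).
  by apply: eq_big_seq => j js; rewrite updE.
have ip := integrable_funrpos measurableT (intg k).
have im := integrable_funrneg measurableT (intg k).
have [ip1 ep] := step _ ip (fun x => funrpos_ge0 _ _).
have [im1 em] := step _ im (fun x => funrneg_ge0 _ _).
have gkE x : g k x = (g k)^\+ x - (g k)^\- x.
  by have /(congr1 (fun h => h x)) <- := funrposBneg (g k).
rewrite /= big_cons.
under [in RHS]eq_Rintegral do rewrite gkE.
rewrite RintegralB// mulrBl -ep -em -RintegralB//.
apply: eq_Rintegral => w _.
by rewrite big_cons gkE mulrBl.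
Qed.

End Independence.

(** ** Products over the lags of normal innovations *)

Section NormalLaw.
Context {R : realType}.
Notation Z := (normal_prob (0 : R) 1).

Lemma integral_normal_prob (f : R -> R) :
  measurable_fun setT f -> (forall x, 0 <= f x) ->
  (\int[Z]_x (f x)%:E =
   \int[lebesgue_measure]_x (f x * normal_pdf 0 1 x)%:E)%E.
Proof.
move=> mf f0; rewrite -[LHS]mul1e.
rewrite -(@eq_ge0_integral_of_indic _ _ _ _ _ lebesgue_measure Z id
  (normal_pdf 0 1) 1)//.
- exact: measurable_normal_pdf.
- by move=> w; exact: normal_pdf_ge0.
move=> B mB; rewrite mul1e.
transitivity (\int[lebesgue_measure]_(x in B) (normal_pdf 0 1 x)%:E)%E => //.
rewrite [RHS]integral_mkcond.
apply: eq_integral => x _.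
by rewrite patchE indicE; case: (x \in B); rewrite ?mul1r ?mul0r.
Qed.

Lemma integral_expR_normal (a : R) :
  (\int[Z]_x (expR (a * x))%:E = (expR (a ^+ 2 / 2))%:E)%E.
Proof.
rewrite integral_normal_prob//; last first.
  by apply: measurableT_comp => //; exact: measurable_funM.
(* Completing the square: the tilted density is a multiple of the normal density with mean [a]. *)
transitivity (\int[lebesgue_measure]_x
    ((expR (a ^+ 2 / 2))%:E * (normal_pdf a 1 x)%:E))%E.
  apply: eq_integral => x _; rewrite -EFinM; congr (_%:E).
  rewrite !normal_pdfE ?oner_neq0// /normal_fun mulrCA.
  rewrite [RHS]mulrCA; congr (_ * _); rewrite -!expRD; congr expR.
  by field.
rewrite ge0_integralZl_EFin//; last 2 first.
- by move=> x _; rewrite lee_fin normal_pdf_ge0.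
- by apply/measurable_EFinP; exact: measurable_normal_pdf.
by rewrite integral_normal_pdf mule1.
Qed.

Lemma integrable_normal_of_expR_bound (f : R -> R) (b : R) :
  measurable_fun setT f -> (forall x, `|f x| <= expR (b * (`|x| + 1))) ->
  Z.-integrable setT (EFin \o f).
Proof.
move=> mf fb.
have me (a : R) : measurable_fun setT (fun x : R => expR (a * x)).
  by apply: measurableT_comp => //; exact: measurable_funM.
have ie (a : R) : Z.-integrable setT (fun x => (expR (a * x))%:E).
  apply/integrableP; split; first by apply/measurable_EFinP; exact: me.
  under eq_integral do rewrite gee0_abs ?lee_fin ?expR_ge0//.
  by rewrite integral_expR_normal ltry.
have : Z.-integrable setT (fun x => ((expR b)%:E *
    ((expR (b * x))%:E + (expR (- b * x))%:E))%E).
  apply: integrableZl => //; exact: integrableD.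
apply: le_integrable => //; first exact/measurable_EFinP.
move=> x _; rewrite /= lee_fin; apply: le_trans (fb x) _.
rewrite [leRHS]ger0_norm; last by rewrite mulr_ge0// ?addr_ge0 ?expR_ge0.
rewrite mulrDr mulr1 expRD mulrC ler_wpM2l ?expR_ge0//.
have h1 := expR_ge0 (b * x); have h2 := expR_ge0 (- (b * x)).
rewrite mulNr; have [x0|x0] := leP 0 (x : R).
  by rewrite (ger0_norm x0); lra.
rewrite (ltr0_norm x0) mulrN; lra.
Qed.

(** With the exponent linear in [b], a product of such integrals is at most [exp] of [K] times the
    sum of the weights, uniformly in the number of factors. *)
Lemma Rintegral_expR_normal_le (b0 : R) : 0 <= b0 ->
  exists2 K : R, 0 <= K & forall b, 0 <= b -> b <= b0 ->
    \int[Z]_x expR (b * (`|x| + 1)) <= expR (K * b).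
Proof.
move=> b00.
pose e (b x : R) : R := expR (b * (`|x| + 1)).
have ie b : Z.-integrable setT (EFin \o e b).
  apply: (@integrable_normal_of_expR_bound _ b).
    apply: measurableT_comp => //; apply: measurable_funM => //.
    exact: measurable_funD.
  by move=> x; rewrite ger0_norm ?expR_ge0.
exists (\int[Z]_x e (b0 + 1) x).
  by apply: Rintegral_ge0 => x _; exact: expR_ge0.
move=> b b0' bb.
have ic : Z.-integrable setT (EFin \o cst (1 : R)).
  exact: finite_measure_integrable_cst.
have ib := integrableZl measurableT b (ie (b0 + 1)).
have i1 : Z.-integrable setT (EFin \o (fun x => 1 + b * e (b0 + 1) x)).
  exact: (integrableD measurableT ic ib).
(* [exp z - 1 <= z exp z] and [y <= exp y] give
   [exp (b y) <= 1 + b exp ((b0 + 1) y)]. *)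
apply: (@le_trans _ _ (\int[Z]_x (1 + b * e (b0 + 1) x))).
  apply: le_Rintegral => //.
    exact: ie.
  move=> x _; rewrite /e.
  set y := `|x| + 1; have y0 : 0 <= y by rewrite addr_ge0.
  have h1 := expR_ge1Dx (- (b * y)).
  have h2 : y <= expR y by have := expR_ge1Dx y; lra.
  have h3 : expR (b * y) - 1 <= b * y * expR (b * y).
    have := ler_wpM2r (expR_ge0 (b * y)) h1.
    by rewrite -expRD addNr expR0; lra.
  have h4 : expR (b * y) <= expR (b0 * y) by rewrite ler_expR ler_wpM2r.
  rewrite mulrDl mul1r expRD.
  have h5 : y * expR (b * y) <= expR (b0 * y) * expR y.
    by rewrite mulrC ler_pM ?expR_ge0.
  have := ler_wpM2l b0' h5.
  lra.
rewrite (RintegralD (f1 := cst 1))//.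
rewrite Rintegral_cst//= probability_setT mulr1 RintegralZl//.
by rewrite mulrC expR_ge1Dx.
Qed.

End NormalLaw.

Lemma cvgn_EFin {R : realType} (u : nat -> R) (l : R) :
  (fun N => (u N)%:E) @ \oo --> l%:E <-> u @ \oo --> l.
Proof.
by split=> [/fine_cvgP[]//|ul]; apply/fine_cvgP; split=> //; exact: nearW.
Qed.

Section InnovationProducts.
Context {d : measure_display} {T : measurableType d} {R : realType}.
Variable P : probability T R.
Context {n : nat}.
Variable eps : int -> 'I_n -> T -> R.
Hypothesis indep : mutually_independent P (fun k : int * 'I_n => eps k.1 k.2).
Hypothesis normal : forall t i, std_normal P (eps t i).
Notation Z := (normal_prob (0 : R) 1).

Lemma Rintegral_prod_eps (s : seq (int * 'I_n)) (f : int * 'I_n -> R -> R) :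
  uniq s -> (forall k, Z.-integrable setT (EFin \o f k)) ->
  P.-integrable setT (fun w => (\prod_(k <- s) f k (eps k.1 k.2 w))%:E) /\
  \int[P]_w (\prod_(k <- s) f k (eps k.1 k.2 w)) =
  \prod_(k <- s) \int[Z]_x f k x.
Proof.
move=> us intf.
have law k B : measurable B -> P (eps k.1 k.2 @^-1` B) = Z B.
  by move=> mB; apply: (normal k.1 k.2).2.
exact: (@Rintegral_prod_indep _ _ _ P _ (fun k => eps k.1 k.2) indep
  (fun=> Z) law s f us intf).
Qed.

Lemma Rintegral_prod_lags (t : int) (N : nat) (f : nat -> 'I_n -> R -> R) :
  (forall u k, Z.-integrable setT (EFin \o f u k)) ->
  P.-integrable setT (fun w =>
    (\prod_(0 <= u < N) \prod_k f u k (eps (t - u%:Z) k w))%:E) /\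
  \int[P]_w (\prod_(0 <= u < N) \prod_k f u k (eps (t - u%:Z) k w)) =
  \prod_(0 <= u < N) \prod_k \int[Z]_x f u k x.
Proof.
move=> intf.
pose s := [seq (t - u%:Z, k) | u <- index_iota 0 N, k <- index_enum 'I_n].
have us : uniq s.
  apply: allpairs_uniq; [exact: iota_uniq|exact: index_enum_uniq|].
  by move=> [u k] [v l] _ _ /= [/addrI/oppr_inj [->] ->].
(* Independence is indexed by time and component, the factors by lag and component; the absolute
   difference with [t] recovers the lag from the time. *)
have sE (V : T -> R) (F : nat -> 'I_n -> R) :
    \prod_(p <- s) F `|t - p.1|%N p.2 = \prod_(0 <= u < N) \prod_k F u k.
  rewrite /s big_allpairs_dep; apply: eq_bigr => u _; apply: eq_bigr => k _ /=.
  by rewrite opprD opprK addrA subrr add0r.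
have sE' (F : nat -> 'I_n -> R -> R) w :
    \prod_(p <- s) F `|t - p.1|%N p.2 (eps p.1 p.2 w) =
    \prod_(0 <= u < N) \prod_k F u k (eps (t - u%:Z) k w).
  rewrite /s big_allpairs_dep; apply: eq_bigr => u _; apply: eq_bigr => k _ /=.
  by rewrite opprD opprK addrA subrr add0r.
have [h1 h2] := @Rintegral_prod_eps s (fun p => f `|t - p.1|%N p.2) us
  (fun p => intf _ _).
split; first by under [X in _.-integrable _ X]funext do rewrite -sE'.
under eq_Rintegral do rewrite -sE'.
by rewrite h2 (sE (fun=> 0) (fun u k => \int[Z]_x f u k x)).
Qed.

Section Domination.
Variables (t : int) (b : nat -> 'I_n -> R) (B : R).
Hypothesis b0 : forall u k, 0 <= b u k.
Hypothesis bB : forall N, \sum_(0 <= u < N) \sum_k b u k <= B.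

Let S N w := \sum_(0 <= u < N) \sum_k b u k * (`|eps (t - u%:Z) k w| + 1).

Let S_nd w : {homo (fun N => S N w) : N M / (N <= M)%N >-> N <= M}.
Proof.
move=> N M NM; rewrite /S [leRHS](big_cat_nat _ NM)//= lerDl sumr_ge0// => u _.
by apply: sumr_ge0 => k _; rewrite mulr_ge0// addr_ge0.
Qed.

(** The envelope is extended-real because it is infinite wherever the weighted sum diverges. The
    partial exponentials increase and, by independence, their expectations stay below
    [exp (K B)]. *)
Lemma integrable_envelope : exists2 D : T -> \bar R, P.-integrable setT D &
  forall N w,
    ((expR (\sum_(0 <= u < N) \sum_k b u k * (`|eps (t - u%:Z) k w| + 1)))%:E
      <= D w)%E.
Proof.
(* Each weight is at most the bound [B] of the sums, so one constant [K] serves all factors. *)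
have bB1 u k : b u k <= B.
  apply: le_trans (bB u.+1); rewrite big_nat_recr//= (bigD1 k)//=.
  rewrite addrCA lerDl addr_ge0 ?sumr_ge0// => j _; exact: sumr_ge0.
have B0 : 0 <= B by have := bB 0; rewrite big_geq.
have [K K0 hK] := @Rintegral_expR_normal_le R B B0.
have ie u k : Z.-integrable setT
    (EFin \o (fun x : R => expR (b u k * (`|x| + 1)))).
  apply: (@integrable_normal_of_expR_bound _ _ (b u k)).
    apply: measurableT_comp => //; apply: measurable_funM => //.
    exact: measurable_funD.
  by move=> x; rewrite ger0_norm ?expR_ge0.
have SE N w : expR (S N w) =
    \prod_(0 <= u < N) \prod_k expR (b u k * (`|eps (t - u%:Z) k w| + 1)).
  by rewrite expR_sum; apply: eq_bigr => u _; rewrite expR_sum.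
have Sint N : P.-integrable setT (EFin \o (fun w => expR (S N w))) /\
    \int[P]_w expR (S N w) <= expR (K * B).
  have [h1 h2] := @Rintegral_prod_lags t N _ ie.
  split; first by under [X in _.-integrable _ X]funext do rewrite /= SE.
  under eq_Rintegral do rewrite SE.
  rewrite h2; apply: (@le_trans _ _
      (\prod_(0 <= u < N) \prod_k expR (K * b u k))).
    apply: ler_prod => u _; rewrite prodr_ge0/=; last first.
      by move=> k _; apply: Rintegral_ge0 => x _; exact: expR_ge0.
    apply: ler_prod => k _; rewrite hK// andbT.
    by apply: Rintegral_ge0 => x _; exact: expR_ge0.
  under eq_bigr do rewrite -expR_sum.
  rewrite -expR_sum ler_expR.
  under eq_bigr do rewrite -mulr_sumr.
  by rewrite -mulr_sumr ler_wpM2l.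
pose D w := limn (fun N => (expR (S N w))%:E).
have Dnd w :
    {homo (fun N => (expR (S N w))%:E) : N M / (N <= M)%N >-> (N <= M)%E}.
  by move=> N M NM; rewrite lee_fin ler_expR S_nd.
have Dcvg w : cvgn (fun N => (expR (S N w))%:E).
  exact: ereal_nondecreasing_is_cvgn (Dnd w).
have DS N w : ((expR (S N w))%:E <= D w)%E.
  apply: lime_ge => //; near=> M; apply: Dnd; near: M.
  exact: nbhs_infty_ge.
have D0 w : (0 <= D w)%E.
  by apply: le_trans (DS 0 w); rewrite lee_fin expR_ge0.
exists D => //.
have mS N : measurable_fun setT (fun w => (expR (S N w))%:E).
  exact: measurable_int (Sint N).1.
have mD : measurable_fun setT D.
  apply: (@emeasurable_fun_cvg _ _ _ _ (fun N w => (expR (S N w))%:E)) => //.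
apply/integrableP; split => //.
under eq_integral do rewrite gee0_abs//.
have lim : (\int[P]_w (expR (S N w))%:E)%E @[N --> \oo] --> (\int[P]_w D w)%E.
  apply: cvg_monotone_convergence => //.
rewrite -(cvg_lim _ lim)//; apply: le_lt_trans (ltry (expR (K * B))).
apply: lime_le; first by apply/cvg_ex; eexists; exact: lim.
apply: nearW => N; rewrite (integral_EFin_Rintegral (Sint N).1) lee_fin.
exact: (Sint N).2.
Unshelve. all: by end_near.
Qed.

(** An integrable envelope is finite almost everywhere, and it bounds the increasing partial sums
    because [y <= exp y]. *)
Lemma ae_cvg_weighted_abs_eps : {ae P, forall w,
  cvgn (series (fun u => \sum_k b u k * (`|eps (t - u%:Z) k w| + 1)))}.
Proof.
have [D Di DS] := integrable_envelope.
have := integrable_ae measurableT Di.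
apply: filterS => w /(_ I) Df.
apply: nondecreasing_is_cvgn; first exact: S_nd.
exists (fine (D w)) => _ [N _ <-].
have := DS N w; rewrite -(fineK Df) lee_fin; apply: le_trans.
by apply: le_trans (expR_ge1Dx _); rewrite lerDr.
Qed.

End Domination.

Section Master.
Variables (g : R -> R) (kappa : R).
Hypothesis mg : measurable_fun setT g.
Hypothesis gk : forall x, `|g x| <= kappa * (`|x| + 1).

Definition monexp (m : nat) (c x : R) : R := x ^+ m * expR (c * g x).

Lemma monexp_bound m c x :
  `|monexp m c x| <= expR ((m%:R + kappa * `|c|) * (`|x| + 1)).
Proof.
rewrite normrM mulrDl expRD; apply: ler_pM => //.
  rewrite normrX; apply: (@le_trans _ _ (expR `|x| ^+ m)).
    rewrite lerXn2r ?nnegrE ?expR_ge0//.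
    by apply: le_trans (expR_ge1Dx _); rewrite lerDr.
  by rewrite -expRM_natl ler_expR ler_wpM2l// lerDl.
rewrite ger0_norm ?expR_ge0// ler_expR.
apply: le_trans (ler_norm _) _; rewrite normrM mulrC mulrAC.
by rewrite ler_wpM2r.
Qed.

Lemma measurable_monexp m c : measurable_fun setT (monexp m c).
Proof.
apply: measurable_funM; first exact: measurable_funX.
by apply: measurableT_comp => //; exact: measurable_funM.
Qed.

Lemma integrable_monexp m c : Z.-integrable setT (EFin \o monexp m c).
Proof.
apply: integrable_normal_of_expR_bound; first exact: measurable_monexp.
exact: monexp_bound.
Qed.

(** Boundedness of the sums forces all but finitely many exponents [m u k] to be 0. Convergence is
    asked only almost everywhere, so the value of [F] where the series diverges is immaterial as
    long as [F] is measurable. *)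
Lemma Rintegral_infinite_prod (t : int) (m : nat -> 'I_n -> nat)
    (c : nat -> 'I_n -> R) (B : R) (F : T -> R) :
  (forall N, \sum_(0 <= u < N) \sum_k ((m u k)%:R + `|c u k|) <= B) ->
  measurable_fun setT F ->
  {ae P, forall w, (fun N => \prod_(0 <= u < N) \prod_k
     monexp (m u k) (c u k) (eps (t - u%:Z) k w)) @ \oo --> F w} ->
  P.-integrable setT (EFin \o F) /\
  (fun N => \prod_(0 <= u < N) \prod_k \int[Z]_x monexp (m u k) (c u k) x)
    @ \oo --> \int[P]_w F w.
Proof.
move=> hB mF cF.
have kappa0 : 0 <= kappa.
  by have := gk 0; rewrite normr0 add0r mulr1; apply: le_trans.
pose b u k := (m u k)%:R + kappa * `|c u k|.
have b0 u k : 0 <= b u k by rewrite addr_ge0// mulr_ge0.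
have bB N : \sum_(0 <= u < N) \sum_k b u k <= (1 + kappa) * B.
  apply: (@le_trans _ _
     ((1 + kappa) * (\sum_(0 <= u < N) \sum_k ((m u k)%:R + `|c u k|)))).
    rewrite mulr_sumr ler_sum// => u _; rewrite mulr_sumr ler_sum// => k _.
    rewrite /b mulrDl mul1r mulrDr.
    have := mulr_ge0 kappa0 (ler0n R (m u k)); have := normr_ge0 (c u k); lra.
  by rewrite ler_wpM2l// addr_ge0.
have [D Di DS] := @integrable_envelope t b _ b0 bB.
pose G N w := \prod_(0 <= u < N) \prod_k
     monexp (m u k) (c u k) (eps (t - u%:Z) k w).
have Gint N := @Rintegral_prod_lags t N _
  (fun u k => integrable_monexp (m u k) (c u k)).
have GD N w : (`|(G N w)%:E| <= D w)%E.
  apply: le_trans (DS N w); rewrite lee_fin /G normr_prod expR_sum.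
  apply: ler_prod => u _; rewrite normr_ge0/= normr_prod expR_sum.
  by apply: ler_prod => k _; rewrite normr_ge0/= monexp_bound.
have cF' : {ae P, forall w, setT w -> (fun N => (G N w)%:E) @ \oo --> (F w)%:E}.
  by apply: filterS cF => w h _; apply/cvgn_EFin.
have [iF _ lim] := @dominated_convergence _ _ _ P setT measurableT
  (fun N w => (G N w)%:E) (EFin \o F) D
  (fun N => measurable_int _ (Gint N).1)
  ((measurable_EFinP _ _).2 mF) cF' Di (aeW _ (fun w N _ => GD N w)).
split => //; apply/cvgn_EFin; rewrite -(integral_EFin_Rintegral iF).
apply: cvg_trans lim; apply: near_eq_cvg; apply: nearW => N /=.
by rewrite -(Gint N).2 -(integral_EFin_Rintegral (Gint N).1).
Qed.

End Master.
End InnovationProducts.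

(** * Measurability of series values and positivity of the infinite products *)

Lemma cvgn_of_limn_einf_esup {R : realType} (u : (\bar R)^nat) :
  limn_einf u = limn_esup u -> u @ \oo --> limn_esup u.
Proof.
move=> e; apply: (@squeeze_cvge _ _ _ _ (einfs u) u (esups u)).
- apply: nearW => N; apply/andP; split.
    by apply: ereal_inf_lbound; exists N => //=.
  by apply: ereal_sup_ubound; exists N => //=.
- by rewrite -e limn_einf_lim; exact: is_cvg_einfs.
- by rewrite limn_esup_lim; exact: is_cvg_esups.
Qed.

(** The default value 0 makes measurability of the set of convergence the point at issue: it is the
    set where the lower and upper limits agree and are finite. *)
Lemma measurable_series_value {d : measure_display} {T : measurableType d}
    {R : realType} (u : nat -> T -> R) :
  (forall v, measurable_fun setT (u v)) ->
  measurable_fun setT (fun w => series_value (fun v => u v w)).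
Proof.
move=> mu.
pose S N w := (series (fun v => u v w) N)%:E.
have mS N : measurable_fun setT (S N).
  by apply/measurable_EFinP; apply: measurable_sum => v; exact: mu.
pose hi w := limn_esup (fun N => S N w).
pose lo w := limn_einf (fun N => S N w).
have mhi : measurable_fun setT hi by exact: measurable_fun_limn_esup.
have mlo : measurable_fun setT lo.
  apply: measurableT_comp => //; apply: measurable_fun_limn_esup => N.
  exact: measurableT_comp.
have -> : (fun w => series_value (fun v => u v w)) = (fun w =>
    if (lo w == hi w) && (hi w == (fine (hi w))%:E) then fine (hi w) else 0).
  apply/funext => w; rewrite /series_value; case: asboolP => [c|nc].
    have /cvgn_EFin c' := c.
    have [e1 e2] := cvg_limn_einf_sup c'.
    by rewrite /lo /hi /S e1 e2 /= !eqxx.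
  case: ifP => // /andP[/eqP e /eqP f]; exfalso; apply: nc.
  have := cvgn_of_limn_einf_esup (fun N => S N w) e.
  rewrite -/(hi w) f => /cvgn_EFin h.
  by apply/cvg_ex; eexists; exact: h.
apply: measurable_fun_ifT.
- apply: measurable_and; first exact: measurable_fun_eqe.
  apply: measurable_fun_eqe => //; apply/measurable_EFinP.
  exact: measurableT_comp.
- exact: measurableT_comp.
- exact: measurable_cst.
Qed.

Lemma Rintegral_gt0 {d : measure_display} {T : measurableType d}
    {R : realType} (P : probability T R) (F : T -> R) :
  P.-integrable setT (EFin \o F) -> (forall w, 0 < F w) ->
  0 < \int[P]_w F w.
Proof.
move=> iF F0; rewrite lt_neqAle Rintegral_ge0 ?andbT//; last first.
  by move=> w _; exact: ltW.
apply/eqP => e0.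
have /ae_eq_integral_abs : measurable_fun setT (EFin \o F).
  exact: measurable_int iF.
move=> /(_ P measurableT) [+ _].
under eq_integral do rewrite /= ger0_norm ?ltW//.
rewrite (integral_EFin_Rintegral iF) -e0 => /(_ erefl).
have nN : ~ P.-negligible [set: T].
  case=> A [mA A0 TA].
  have : (P setT <= P A)%E by apply: le_measure; rewrite ?inE.
  by rewrite A0 probability_setT lee_fin ler10.
apply: contra_not nN; apply: negligibleS => w _ /= /(_ I) /= [] Fw0.
by have := F0 w; rewrite Fw0 ltxx.
Qed.

Section ExponentialProducts.
Context {d : measure_display} {T : measurableType d} {R : realType}.
Variable P : probability T R.
Context {n : nat}.
Variable eps : int -> 'I_n -> T -> R.
Hypothesis indep : mutually_independent P (fun k : int * 'I_n => eps k.1 k.2).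
Hypothesis normal : forall t i, std_normal P (eps t i).
Notation Z := (normal_prob (0 : R) 1).
Variables (g : R -> R) (kappa : R).
Hypothesis mg : measurable_fun setT g.
Hypothesis gk : forall x, `|g x| <= kappa * (`|x| + 1).

Lemma prod_monexp (s : seq nat) (m : nat -> 'I_n -> nat)
    (c X : nat -> 'I_n -> R) :
  \prod_(u <- s) \prod_k monexp g (m u k) (c u k) (X u k) =
  (\prod_(u <- s) \prod_k X u k ^+ m u k) *
  expR (\sum_(u <- s) \sum_k c u k * g (X u k)).
Proof.
rewrite expR_sum -big_split; apply: eq_bigr => u _.
by rewrite expR_sum -big_split.
Qed.

(** Convergence of an infinite product includes a nonzero limit. Here the limit is the expectation
    of the exponential of a random series, hence positive. *)
Lemma exists_pos_infinite_prod (c : nat -> 'I_n -> R) (B : R) :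
  (forall N, \sum_(0 <= u < N) \sum_k `|c u k| <= B) ->
  exists2 L : R, 0 < L &
  (fun N => \prod_(0 <= u < N) \prod_k \int[Z]_x monexp g 0 (c u k) x)
    @ \oo --> L.
Proof.
move=> hB.
(* The innovations up to time 0 are an arbitrary carrier: the products of integrals depend on [c]
   alone. *)
pose e w u := \sum_k c u k * g (eps (0 - u%:Z) k w).
pose F w := expR (series_value (e w)).
have mF : measurable_fun setT F.
  apply: measurableT_comp => //; apply: measurable_series_value => u.
  apply: measurable_sum => k; apply: measurable_funM => //.
  by apply: measurableT_comp (indep.1 (0 - u%:Z, k)).
have cF : {ae P, forall w, (fun N => \prod_(0 <= u < N) \prod_k
    monexp g 0 (c u k) (eps (0 - u%:Z) k w)) @ \oo --> F w}.
  have := @ae_cvg_weighted_abs_eps _ _ _ P _ eps indep normal 0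
    (fun u k => `|c u k|) B (fun u k => normr_ge0 _) hB.
  apply: filterS => w cw.
  have ce : cvgn (series (e w)).
    apply: normed_cvg; apply: (@series_le_cvg _ _ (fun u => kappa *
      \sum_k `|c u k| * (`|eps (0 - u%:Z) k w| + 1))).
    - by move=> u /=.
    - move=> u; rewrite mulr_sumr sumr_ge0// => k _.
      by rewrite mulrCA mulr_ge0//; apply: le_trans (gk _).
    - move=> u; rewrite mulr_sumr; apply: le_trans (ler_norm_sum _ _ _) _.
      by apply: ler_sum => k _; rewrite normrM mulrCA ler_wpM2l.
    exact: is_cvg_seriesZ.
  rewrite /F /series_value; case: asboolP => // _.
  have := cvg_comp _ _ ce (@continuous_expR R _).
  apply: cvg_trans; apply: near_eq_cvg; apply: nearW => N /=.
  rewrite (prod_monexp (index_iota 0 N) (fun _ _ => 0%N)) /series/=.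
  by rewrite [X in X * _]big1 ?mul1r// => u _; rewrite big1.
have hB' N : \sum_(0 <= u < N) \sum_k ((0%N)%:R + `|c u k|) <= B.
  by under eq_bigr do under eq_bigr do rewrite add0r.
have [iF lim] := @Rintegral_infinite_prod _ _ _ P _ eps indep normal g kappa
  mg gk 0 (fun _ _ => 0%N) c B F hB' mF cF.
by exists (\int[P]_w F w) => //; apply: Rintegral_gt0 => // w; exact: expR_gt0.
Qed.

Lemma Rintegral_block (t : int) (m : 'I_n -> nat) (c : 'I_n -> R) :
  P.-integrable setT (fun w =>
    ((\prod_k eps t k w ^+ m k) * expR (\sum_k c k * g (eps t k w)))%:E) /\
  \int[P]_w ((\prod_k eps t k w ^+ m k) * expR (\sum_k c k * g (eps t k w)))
    = \prod_k \int[Z]_x monexp g (m k) (c k) x.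
Proof.
have := @Rintegral_prod_lags _ _ _ P _ eps indep normal t 1
  (fun _ k => monexp g (m k) (c k))
  (fun _ k => @integrable_monexp _ g kappa mg gk (m k) (c k)).
rewrite big_nat1.
suff E w : \prod_(0 <= u < 1) \prod_k monexp g (m k) (c k) (eps (t - u%:Z) k w)
    = (\prod_k eps t k w ^+ m k) * expR (\sum_k c k * g (eps t k w)).
  by under eq_fun do rewrite E; under eq_Rintegral do rewrite E.
rewrite big_nat1 subr0.
have := prod_monexp [:: 0] (fun _ => m) (fun _ => c) (fun _ k => eps t k w).
by rewrite !big_seq1.
Qed.

End ExponentialProducts.

(** ** Moments of the stationary solution *)

Lemma cvgn_unique {R : realType} {u : nat -> R} {a b : R} :
  u @ \oo --> a -> u @ \oo --> b -> a = b.
Proof. by move=> ua ub; apply: (cvg_unique _ ua ub). Qed.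

(** * Weak stationarity from moments at nonnegative lags *)

Section WeakStationarity.
Context {d : measure_display} {T : measurableType d} {R : realType}.
Variable P : probability T R.
Context {n : nat}.
Variable Y : int -> 'I_n -> T -> R.
Hypothesis int_pow : forall t i p,
  P.-integrable setT (EFin \o (fun w => Y t i w ^+ p)).
Hypothesis mean : forall t i, 'E_P[Y t i]%E = 'E_P[Y 0 i]%E.
Hypothesis int_prod : forall t (h : nat) i j,
  P.-integrable setT (EFin \o (fun w => Y (t + h%:Z) i w * Y t j w)).
Hypothesis prod_shift : forall t t' (h : nat) i j,
  \int[P]_w (Y (t + h%:Z) i w * Y t j w) =
  \int[P]_w (Y (t' + h%:Z) i w * Y t' j w).

(** A negative lag becomes a positive one when the earlier time is taken as base and the two factors
    are exchanged. *)
Lemma lagged_product (t h : int) i j :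
  P.-integrable setT (EFin \o (fun w => Y (t + h) i w * Y t j w)) /\
  \int[P]_w (Y (t + h) i w * Y t j w) = \int[P]_w (Y h i w * Y 0 j w).
Proof.
have sym (s s' : int) k l : (fun w => Y s k w * Y s' l w) =
    (fun w => Y s' l w * Y s k w).
  by apply/funext => w; rewrite mulrC.
case: h => m.
  by split; rewrite ?(prod_shift t 0) ?add0r//; exact: int_prod.
have te s : (s + Negz m) + m.+1%:Z = s by rewrite NegzE subrK.
have := int_prod (t + Negz m) m.+1 j i.
have := prod_shift (t + Negz m) (0 + Negz m) m.+1 j i.
by rewrite !te add0r => e1 i1; rewrite !(sym _ _ i j).
Qed.

Lemma weakly_stationary_of_moments : weakly_stationary P Y.
Proof.
split; first by move=> t i; exact: (int_pow t i 2).
split; first exact: mean.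
move=> t h i j.
have L1 s k : Y s k \in Lfun P 1.
  apply/Lfun1_integrable; have := int_pow s k 1.
  by under eq_fun do rewrite expr1.
have LM (s u : int) k l : (Y s k * Y u l)%R \in Lfun P 1.
  apply/Lfun1_integrable; have [+ _] := lagged_product u (s - u) k l.
  by rewrite addrC subrK.
have E2 (s u : int) k l :
    ('E_P[(Y s k * Y u l)%R] = (\int[P]_w (Y s k w * Y u l w))%R%:E)%E.
  rewrite unlock; apply: integral_EFin_Rintegral.
  by have /Lfun1_integrable := LM s u k l.
rewrite !covarianceE// !E2 (lagged_product t h i j).2.
by rewrite (mean (t + h)) (mean h) (mean t).
Qed.

End WeakStationarity.

(** * The log-volatility as a series in the innovations *)

Section LogVolatility.
Context {d : measure_display} {T : measurableType d} {R : realType}.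
Variable P : probability T R.
Context {n : nat}.
Variable eps : int -> 'I_n -> T -> R.
Hypothesis indep : mutually_independent P (fun k : int * 'I_n => eps k.1 k.2).
Hypothesis normal : forall t i, std_normal P (eps t i).
Variables (S W1 K : 'M[R]_n) (alpha1 : 'cV[R]_n).
Variables (rho0 rho1 lambda1 Theta xi : R).
Hypothesis SK : S *m K = 1%:M - lambda1 *: S.
Variables (C r : R).
Hypotheses (C0 : 0 <= C) (r0 : 0 < r) (r1 : r < 1).
Hypothesis Sr : forall v i j, `|((lambda1 *: S) ^+ v) i j| <= C * r ^+ v.
Notation Z := (normal_prob (0 : R) 1).
Notation Yt := (Yterm P S W1 alpha1 rho0 rho1 lambda1 Theta xi eps).
Notation B := (lambda1 *: S).

Definition gsc (x : R) : R := Theta * x + xi * (`|x| - \int[Z]_y `|y|).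

Let kappa := `|Theta| + `|xi| * (1 + \int[Z]_y `|y|).

Lemma measurable_gsc : measurable_fun setT gsc.
Proof.
apply: measurable_funD; first exact: measurable_funM.
by apply: measurable_funM => //; apply: measurable_funB.
Qed.

Lemma gsc_bound x : `|gsc x| <= kappa * (`|x| + 1).
Proof.
have m0 : 0 <= \int[Z]_y `|y| by apply: Rintegral_ge0.
apply: le_trans (ler_normD _ _) _; rewrite !normrM /kappa mulrDl lerD//.
  by rewrite ler_wpM2l// lerDl.
rewrite -mulrA ler_wpM2l//; apply: le_trans (ler_normB _ _) _.
rewrite normr_id (ger0_norm m0) mulrDl mul1r mulrDr mulr1.
have := mulr_ge0 m0 (normr_ge0 x); lra.
Qed.

(** The centring [E|eps_t(s_i)|] is the first absolute moment of the standard normal law for all [t]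
    and [i], so one scalar function acts at all times and components. *)
Lemma g_atE t w k : g_at P Theta xi eps t w k 0 = gsc (eps t k w).
Proof.
rewrite /g_at /gfun !mxE /gsc; congr (_ + _ * (_ - _)).
have ia : Z.-integrable setT (EFin \o (fun x : R => `|x|)).
  apply: (@integrable_normal_of_expR_bound _ _ 1) => //.
  move=> x; rewrite normr_id mul1r; apply: le_trans (expR_ge1Dx _).
  by lra.
have [] := @Rintegral_prod_eps _ _ _ P _ _ indep normal [:: (t, k)]
  (fun _ x => `|x|) isT (fun=> ia).
rewrite big_seq1 => _ <-; rewrite unlock /Rintegral; congr fine.
by apply: eq_integral => y _; rewrite big_seq1.
Qed.

(* Coefficient of [g(eps_(t-v))] in [ln h_t]; for [v > 0] it merges the
   contributions of [Delta_(t-v)] and [Delta_(t-v+1)]. *)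
Definition lag_coef (v : nat) : 'M[R]_n :=
  if v is u.+1 then
    lambda1 ^+ u *: (S ^+ u.+1 *m ((rho0 * lambda1) *: (S *m W1) + rho1 *: 1%:M))
  else rho0 *: (S *m W1).

Arguments lag_coef : simpl never.

(** The first summand stems from [Delta_(t-u-1)], the second from the lagged innovation inside
    [Delta_(t-u)]. *)
Lemma lag_coefS u : lag_coef u.+1 =
  rho0 *: (B ^+ u.+1 *m S *m W1) + rho1 *: (B ^+ u *m S).
Proof.
rewrite /lag_coef mulmxDr scalerDr !scalemx_exp -!scalemxAr mulmx1.
rewrite -!scalemxAl !scalerA; congr (_ *: _ + _ *: _).
- by rewrite exprS; ring.
- by rewrite !mulmxA.
- by rewrite mulrC.
- by rewrite exprSr.
Qed.

Lemma lag_coef_bound :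
  exists2 C1, 0 <= C1 & forall v i k, `|lag_coef v i k| <= C1 * r ^+ v.
Proof.
pose N := S *m ((rho0 * lambda1) *: (S *m W1) + rho1 *: 1%:M).
pose D := \sum_j \sum_l `|N j l|.
have D0 : 0 <= D by apply: sumr_ge0 => *; exact: sumr_ge0.
pose D1 := \sum_j \sum_l `|(rho0 *: (S *m W1)) j l|.
have D10 : 0 <= D1 by apply: sumr_ge0 => *; exact: sumr_ge0.
have CD0 : 0 <= C * D / r by rewrite divr_ge0 ?mulr_ge0// ltW.
(* [D1] covers lag 0; at lag [v.+1] only [v] powers of [lambda1 S] decay, hence the division by
   [r]. *)
exists (D1 + C * D / r); first exact: addr_ge0.
case=> [|v] i k.
  rewrite expr0 mulr1 /lag_coef /D1 (bigD1 i)//= (bigD1 k)//= -!addrA lerDl.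
  by rewrite !addr_ge0// ?sumr_ge0// => *; exact: sumr_ge0.
have -> : lag_coef v.+1 = B ^+ v *m N.
  by rewrite /lag_coef scalemx_exp -scalemxAl exprSr -mulmxE -mulmxA.
apply: le_trans (mulmx_entry_bound _ _ _ i k (Sr v)) _.
rewrite mulrDl [C * D / r * _]mulrAC exprS -/D.
have -> : C * D * (r * r ^+ v) / r = C * r ^+ v * D by field; rewrite gt_eqF.
by rewrite lerDr mulr_ge0// mulr_ge0 ?exprn_ge0// ltW.
Qed.

Notation G := (g_at P Theta xi eps).

Lemma mulmx_G_bound (Q : 'M[R]_n) c u t i w : 0 <= c ->
  (forall k, `|Q i k| <= c * r ^+ u) ->
  `|(Q *m G t w) i 0| <= c * kappa * \sum_k r ^+ u * (`|eps t k w| + 1).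
Proof.
move=> c0 hQ; rewrite mxE mulr_sumr; apply: le_trans (ler_norm_sum _ _ _) _.
apply: ler_sum => k _; rewrite normrM g_atE mulrA -mulrA.
rewrite [leRHS](_ : _ = (c * r ^+ u) * (kappa * (`|eps t k w| + 1))); last by ring.
by rewrite ler_pM// gsc_bound.
Qed.

Lemma measurable_mulmx_G (Q : 'M[R]_n) t i :
  measurable_fun setT (fun w => (Q *m G t w) i 0).
Proof.
under eq_fun do rewrite mxE.
apply: measurable_sum => k; under eq_fun do rewrite g_atE.
apply: measurable_funM => //; apply: measurableT_comp (indep.1 (t, k)).
exact: measurable_gsc.
Qed.

Lemma YtermE t i w v : Yt t i w v = (B ^+ v *m S *m alpha1) i 0 +
  (rho0 *: (B ^+ v *m S *m W1) *m G (t - v%:Z) w) i 0 +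
  (rho1 *: (B ^+ v *m S) *m G (t - v.+1%:Z) w) i 0.
Proof.
rewrite /Yterm /Delta -scalemx_exp.
have -> : t - v%:Z - 1 = t - v.+1%:Z by rewrite -addn1 PoszD opprD addrA.
move: (G (t - v%:Z) w) (G (t - v.+1%:Z) w) => G1 G2.
rewrite !mulmxDr -!scalemxAr -!scalemxAl !mulmxA.
by rewrite [in LHS]mxE [X in X + _]mxE.
Qed.

Lemma measurable_Yterm t i v : measurable_fun setT (fun w => Yt t i w v).
Proof.
under eq_fun do rewrite YtermE.
by repeat apply: measurable_funD => //; exact: measurable_mulmx_G.
Qed.

(** The last term is the boundary term: the [rho1] part of [Delta_(t-N)], whose [rho0] partner
    enters only with [Delta_(t-N-1)]. *)
Lemma series_YtermE t i w N : series (Yt t i w) N.+1 =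
  \sum_(0 <= v < N.+1) (B ^+ v *m S *m alpha1) i 0 +
  \sum_(0 <= u < N.+1) (lag_coef u *m G (t - u%:Z) w) i 0 +
  (rho1 *: (B ^+ N *m S) *m G (t - N.+1%:Z) w) i 0.
Proof.
elim: N => [|N IH].
  by rewrite /series /= !big_nat1 YtermE expr0 mul1mx.
have -> : series (Yt t i w) N.+2 = series (Yt t i w) N.+1 + Yt t i w N.+1.
  by rewrite /series /= big_nat_recr.
rewrite IH.
rewrite [in RHS]big_nat_recr//= [X in _ = _ + X + _]big_nat_recr//=.
rewrite YtermE lag_coefS mulmxDl [X in _ = _ + (_ + X) + _]mxE.
ring.
Qed.

Lemma ae_cvg_log_volatility t i : {ae P, forall w,
  cvgn (series (Yt t i w)) /\
  (fun N => (invmx K *m alpha1) i 0 +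
     \sum_(0 <= u < N) (lag_coef u *m G (t - u%:Z) w) i 0) @ \oo
     --> series_value (Yt t i w)}.
Proof.
have := @ae_cvg_weighted_abs_eps _ _ _ P _ eps indep normal t
  (fun u _ => r ^+ u) (n%:R * (1 - r)^-1) (fun u _ => exprn_ge0 u (ltW r0)).
have hB N : \sum_(0 <= u < N) \sum_(k < n) r ^+ u <= n%:R * (1 - r)^-1.
  under eq_bigr do rewrite sumr_const card_ord -mulr_natl.
  by rewrite -mulr_sumr ler_wpM2l// sum_geometric_le.
move=> /(_ hB); apply: filterS => w cw.
have lim1 : (fun N => \sum_(0 <= v < N) (B ^+ v *m S *m alpha1) i 0) @ \oo
    --> (invmx K *m alpha1) i 0.
  rewrite mxE.
  have : (fun N => \sum_j (\sum_(0 <= v < N) (B ^+ v *m S) i j) * alpha1 j 0)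
      @ \oo --> \sum_j invmx K i j * alpha1 j 0.
    apply: cvg_finite_sum => j; apply: cvgMl.
    exact: (@cvg_geometric_mx _ _ S K lambda1 SK C r r0 r1 Sr).
  apply: cvg_trans; apply: near_eq_cvg; apply: nearW => N.
  under [RHS]eq_bigr do rewrite mxE.
  rewrite exchange_big; apply: eq_bigr => j _; exact: mulr_suml.
have [C1 C10 hC1] := lag_coef_bound.
have c2 : cvgn (series (fun u => (lag_coef u *m G (t - u%:Z) w) i 0)).
  apply: normed_cvg; apply: (@series_le_cvg _ _ (fun u => C1 * kappa *
    \sum_k r ^+ u * (`|eps (t - u%:Z) k w| + 1))).
  - by move=> u /=.
  - move=> u; apply: le_trans (normr_ge0 _)
      (@mulmx_G_bound (lag_coef u) C1 u _ i _ C10 _).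
    by move=> k; exact: hC1.
  - by move=> u; apply: mulmx_G_bound => // k; exact: hC1.
  exact: is_cvg_seriesZ.
have lim3 : (fun N => (rho1 *: (B ^+ N *m S) *m G (t - N.+1%:Z) w) i 0) @ \oo
   --> (0 : R).
  pose D := \sum_j \sum_l `|S j l|.
  have D0 : 0 <= D by apply: sumr_ge0 => *; exact: sumr_ge0.
  (* Up to a constant, [e] is the general term of the convergent series [cw], so it tends to 0. The
     boundary term involves the innovation of lag [N.+1] but only the rate [r ^+ N], hence again the
     division by [r]. *)
  pose e N := `|rho1| * (C * D / r) * kappa *
    \sum_k r ^+ N * (`|eps (t - N%:Z) k w| + 1).
  have e0 : (fun N => e N.+1) @ \oo --> (0 : R).
    rewrite (cvg_shiftS e); have := cvg_series_cvg_0 cw.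
    move=> /(cvgMr (a := `|rho1| * (C * D / r) * kappa)); rewrite mulr0; exact.
  have e0' : (fun N => - e N.+1) @ \oo --> (0 : R).
    by rewrite -oppr0; exact: cvgN.
  apply: squeeze_cvgr e0' e0; apply: nearW => N; rewrite -ler_norml.
  apply: mulmx_G_bound.
    by rewrite mulr_ge0// divr_ge0 ?mulr_ge0// ltW.
  move=> k; rewrite mxE normrM.
  rewrite [leRHS](_ : _ = `|rho1| * (C * r ^+ N * D)); last first.
    by rewrite exprS; field; rewrite gt_eqF.
  by rewrite ler_wpM2l// mulmx_entry_bound.
have c2' := c2.
set l2 := limn (series (fun u => (lag_coef u *m G (t - u%:Z) w) i 0)) in c2'.
have limY : series (Yt t i w) @ \oo --> (invmx K *m alpha1) i 0 + l2.
  rewrite -(cvg_shiftS (series (Yt t i w))) -(addr0 (_ i 0 + l2)).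
  under eq_fun do rewrite series_YtermE.
  apply: cvgD lim3; apply: cvgD.
    by rewrite (cvg_shiftS
      (fun N => \sum_(0 <= v < N) (B ^+ v *m S *m alpha1) i 0)).
  by rewrite (cvg_shiftS
    (series (fun u => (lag_coef u *m G (t - u%:Z) w) i 0))).
have cY : cvgn (series (Yt t i w)) by apply/cvg_ex; eexists; exact: limY.
split=> //; rewrite /series_value; case: asboolP => // _.
rewrite (cvg_lim _ limY)//; apply: cvgD => //; exact: cvg_cst.
Qed.


(** * Joint moments of the solution at two times *)

Notation Y := (Ysol P S W1 alpha1 rho0 rho1 lambda1 Theta xi eps).

Lemma measurable_Ysol t i : measurable_fun setT (Y t i).
Proof.
apply: measurable_funM; first exact: (indep.1 (t, i)).
apply: measurableT_comp => //; apply: measurable_funM => //.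
by apply: measurable_series_value => v; exact: measurable_Yterm.
Qed.

(* Exponents and weights of the innovations at time [t + h - u] in the moment
   [E (Y_(t+h)(s_i)^p Y_t(s_j)^q)]. *)
Definition lag_exponent (p q h : nat) (i j : 'I_n) (u : nat) (k : 'I_n) : nat :=
  (((u == 0%N) && (k == i)) * p + ((u == h) && (k == j)) * q)%N.

Definition lag_weight (p q h : nat) (i j : 'I_n) (u : nat) (k : 'I_n) : R :=
  p%:R / 2 * lag_coef u i k +
  (if (h <= u)%N then q%:R / 2 * lag_coef (u - h) j k else 0).

Definition level_factor (p q : nat) (i j : 'I_n) : R :=
  expR (p%:R / 2 * (invmx K *m alpha1) i 0 + q%:R / 2 * (invmx K *m alpha1) j 0).

Lemma lag_bounded p q h i j : exists B, forall N,
  \sum_(0 <= u < N) \sum_k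
    ((lag_exponent p q h i j u k)%:R + `|lag_weight p q h i j u k|) <= B.
Proof.
have [C1 C10 hC1] := lag_coef_bound.
have rh0 : 0 < r ^- h by rewrite invr_gt0 exprn_gt0.
(* Exponents occur only at lags [u <= h], where [r ^- h * r ^+ u >= 1]; the same factor [r ^- h]
   pays for the shifted lag [u - h] in the weight. *)
pose D := (p + q)%:R * r ^- h + (p%:R / 2 * C1 + q%:R / 2 * C1 * r ^- h).
have hD u k : (lag_exponent p q h i j u k)%:R + `|lag_weight p q h i j u k|
    <= D * r ^+ u.
  rewrite mulrDl lerD//.
    have [uh|hu] := leqP u h; last first.
      rewrite /lag_exponent [u == h]gtn_eqF// [u == 0%N]gtn_eqF ?(leq_trans _ hu)//.
      by rewrite !mul0n mulr_ge0 ?exprn_ge0// ?mulr_ge0// ltW.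
    apply: (@le_trans _ _ (p + q)%:R).
      rewrite ler_nat /lag_exponent leq_add//.
        by case: (_ && _) => //=; rewrite mul1n.
      by case: (_ && _) => //=; rewrite mul1n.
    rewrite -mulrA ler_peMr// mulrC ler_pdivlMr ?exprn_gt0// mul1r.
    by rewrite ler_wiXn2l// ltW.
  apply: le_trans (ler_normD _ _) _; rewrite mulrDl lerD//.
    rewrite normrM ger0_norm ?divr_ge0// -[leRHS]mulrA ler_wpM2l ?divr_ge0//.
  case: ifP => hu; last first.
    rewrite normr0 mulr_ge0 ?exprn_ge0 ?(ltW r0)//.
    by rewrite mulr_ge0 ?(ltW rh0)// mulr_ge0// divr_ge0.
  rewrite normrM ger0_norm ?divr_ge0// -[leRHS]mulrA -[leRHS]mulrA.
  rewrite ler_wpM2l ?divr_ge0//.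
  apply: le_trans (hC1 _ _ _) _; rewrite ler_wpM2l// le_eqVlt.
  apply/orP; left; apply/eqP; rewrite -{2}(subnK hu) exprD mulrCA.
  by rewrite mulVf ?mulr1// gt_eqF// exprn_gt0.
have D0 : 0 <= D.
  by rewrite !addr_ge0// !mulr_ge0// ?divr_ge0// ltW.
exists (D * (n%:R * (1 - r)^-1)) => N.
apply: (@le_trans _ _ (\sum_(0 <= u < N) \sum_(k < n) D * r ^+ u)).
  by apply: ler_sum => u _; apply: ler_sum => k _; exact: hD.
under eq_bigr do rewrite sumr_const card_ord -mulr_natl mulrCA.
by rewrite -mulr_sumr ler_wpM2l// -mulr_sumr ler_wpM2l// sum_geometric_le.
Qed.

Lemma prod_indicator_exponent (X : nat -> 'I_n -> R) N h j q : (h < N)%N ->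
  \prod_(0 <= u < N) \prod_k X u k ^+ (((u == h) && (k == j)) * q) = X h j ^+ q.
Proof.
move=> hN; rewrite big_mkord (bigD1 (Ordinal hN))//= (bigD1 j)//= !eqxx mul1n.
rewrite big1 ?mulr1 => [|k kj]; last by rewrite (negbTE kj) andbF.
rewrite big1 ?mulr1// => u uh; rewrite big1// => k _.
suff -> : (u == h :> nat) = false by [].
by apply/negbTE; apply: contra uh => /eqP e; apply/eqP/val_inj.
Qed.

(** Length [N.+1 + h] ensures that lag [h] is present and leaves exactly [N.+1] terms for the
    later-starting factor of exponent [q]. *)
Lemma prod_lags p q h i j (X : nat -> 'I_n -> R) N :
  \prod_(0 <= u < N.+1 + h) \prod_k monexp gsc
     (lag_exponent p q h i j u k) (lag_weight p q h i j u k) (X u k) =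
  X 0 i ^+ p * X h j ^+ q *
  expR (p%:R / 2 *
      (\sum_(0 <= u < N.+1 + h) \sum_k lag_coef u i k * gsc (X u k)) +
    q%:R / 2 * \sum_(0 <= u < N.+1) \sum_k lag_coef u j k * gsc (X (u + h)%N k)).
Proof.
rewrite prod_monexp; congr (_ * expR _).
  under eq_bigr do under eq_bigr do rewrite exprD.
  under eq_bigr do rewrite big_split.
  rewrite big_split /= !prod_indicator_exponent//.
  by rewrite addSn ltnS leq_addl.
under eq_bigr do under eq_bigr do rewrite mulrDl -(mulrA (p%:R / 2)).
under eq_bigr do rewrite big_split /= -mulr_sumr.
rewrite big_split /= -mulr_sumr; congr (_ + _).
rewrite (@big_cat_nat _ _ _ h) ?leq_addl//= big1_seq ?add0r; last first.
  move=> u; rewrite mem_index_iota => /andP[_ /andP[_ uh]]; rewrite big1// => k _.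
  by rewrite leqNgt uh mul0r.
rewrite -{1}(add0n h) big_addn addnK mulr_sumr; apply: eq_bigr => u _.
rewrite mulr_sumr; apply: eq_bigr => k _.
by rewrite leq_addl addnK mulrA.
Qed.

(** The products contain innovations only, so the deterministic part of the log-volatilities is
    divided out as [level_factor]. The products of integrals do not mention [t], which is the source
    of stationarity. *)
Lemma moment (t : int) (h : nat) i j p q :
  let F w := Y (t + h%:Z) i w ^+ p * Y t j w ^+ q in
  P.-integrable setT (EFin \o F) /\
  (fun N => \prod_(0 <= u < N) \prod_k \int[Z]_x monexp gsc
     (lag_exponent p q h i j u k) (lag_weight p q h i j u k) x) @ \oo
  --> (level_factor p q i j)^-1 * \int[P]_w F w.
Proof.
move=> F; pose e := level_factor p q i j.
have e0 : e != 0 by rewrite gt_eqF// expR_gt0.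
have mF : measurable_fun setT F.
  by apply: measurable_funM; apply: measurable_funX; exact: measurable_Ysol.
have mF' : measurable_fun setT (fun w => e^-1 * F w) by exact: measurable_funM.
have [B0 hB0] := lag_bounded p q h i j.
have cF : {ae P, forall w, (fun N => \prod_(0 <= u < N) \prod_k monexp gsc
    (lag_exponent p q h i j u k) (lag_weight p q h i j u k)
    (eps (t + h%:Z - u%:Z) k w)) @ \oo --> e^-1 * F w}.
  have := ae_cvg_log_volatility t j; have := ae_cvg_log_volatility (t + h%:Z) i.
  apply: filterS2 => w [_ c1] [_ c2].
  pose s1 N := \sum_(0 <= u < N) \sum_k
    lag_coef u i k * gsc (eps (t + h%:Z - u%:Z) k w).
  pose s2 N := \sum_(0 <= u < N) \sum_k lag_coef u j k * gsc (eps (t - u%:Z) k w).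
  have sE (t' : int) (i' : 'I_n) N :
      \sum_(0 <= u < N) (lag_coef u *m G (t' - u%:Z) w) i' 0 =
      \sum_(0 <= u < N) \sum_k lag_coef u i' k * gsc (eps (t' - u%:Z) k w).
    apply: eq_bigr => u _; rewrite mxE; apply: eq_bigr => k _.
    by rewrite g_atE.
  set a1 := (invmx K *m alpha1) i 0 in c1.
  set a2 := (invmx K *m alpha1) j 0 in c2.
  set v1 := series_value _ in c1; set v2 := series_value _ in c2.
  have l1 : s1 @ \oo --> v1 - a1.
    have ca : (fun _ : nat => a1) @ \oo --> a1 by exact: cvg_cst.
    have -> : s1 = (fun N => a1 + \sum_(0 <= u < N)
        (lag_coef u *m G (t + h%:Z - u%:Z) w) i 0 - a1).
      by apply/funext => N; rewrite sE addrAC subrr add0r.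
    exact: cvgB c1 ca.
  have l2 : s2 @ \oo --> v2 - a2.
    have ca : (fun _ : nat => a2) @ \oo --> a2 by exact: cvg_cst.
    have -> : s2 = (fun N => a2 + \sum_(0 <= u < N)
        (lag_coef u *m G (t - u%:Z) w) j 0 - a2).
      by apply/funext => N; rewrite sE addrAC subrr add0r.
    exact: cvgB c2 ca.
  have FE : e^-1 * F w = eps (t + h%:Z) i w ^+ p * eps t j w ^+ q *
      expR (p%:R / 2 * (v1 - a1) + q%:R / 2 * (v2 - a2)).
    rewrite /F /Ysol -/v1 -/v2 !exprMn -!expRM_natl /e /level_factor -expRN.
    rewrite -/a1 -/a2.
    rewrite [RHS](_ : _ = eps (t + h%:Z) i w ^+ p * eps t j w ^+ q *
      (expR (- (p%:R / 2 * a1 + q%:R / 2 * a2)) *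
        (expR (p%:R * (2^-1 * v1)) * expR (q%:R * (2^-1 * v2))))); first by ring.
    by rewrite -!expRD; congr (_ * expR _); ring.
  rewrite FE.
  have lim : (fun N => eps (t + h%:Z) i w ^+ p * eps t j w ^+ q *
      expR (p%:R / 2 * s1 (N.+1 + h)%N + q%:R / 2 * s2 N.+1)) @ \oo -->
      eps (t + h%:Z) i w ^+ p * eps t j w ^+ q *
      expR (p%:R / 2 * (v1 - a1) + q%:R / 2 * (v2 - a2)).
    apply: cvgMr; apply: (@cvg_comp _ _ _ _ expR _ _ _ _ (@continuous_expR R _)).
    apply: cvgD; apply: cvgMr.
      rewrite (cvg_shiftS (fun N => s1 (N + h)%N)) (cvg_shiftn h s1).
      exact: l1.
    by rewrite (cvg_shiftS s2).
  (* The limit is unaffected by shifting the index to the length [N.+1 + h] at which the products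
     factor. *)
  rewrite -(cvg_shiftn h) -cvg_shiftS.
  apply: cvg_trans lim; apply: near_eq_cvg; apply: nearW => N /=.
  rewrite (prod_lags p q h i j (fun u k => eps (t + h%:Z - u%:Z) k w)).
  rewrite subr0 addrK; congr (_ * expR (_ + _ * _)).
  apply: eq_bigr => u _; apply: eq_bigr => k _; congr (_ * gsc (eps _ k w)).
  by rewrite PoszD; ring.
have [iF lim] := @Rintegral_infinite_prod _ _ _ P _ eps indep normal gsc kappa
  measurable_gsc gsc_bound (t + h%:Z) _ _ B0 _ hB0 mF' cF.
have iF1 : P.-integrable setT (EFin \o F).
  have := integrableZl measurableT e iF.
  apply: eq_integrable => // w _; rewrite /= -EFinM mulrA divff// mul1r.
  by [].
split => //; apply: cvg_trans lim _.
by rewrite -RintegralZl.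
Qed.

(** At [h = 0] powers of innovations occur only at lag 0, whose factor is split off; the remaining
    lags form [L]. [L] precedes the quantifier over [t], and the factors may be written with [eps 1]
    since their integrals are the same at every time. *)
Lemma moment_formula i j p q :
  P.-integrable setT (fun w => (eps 1 i w ^+ p * eps 1 j w ^+ q *
    expR (\sum_k lag_weight p q 0 i j 0 k * gsc (eps 1 k w)))%:E) /\
  exists L : R, 0 < L /\
  ((fun N => \prod_(1 <= v < N.+1) 'E_P[fun w =>
      expR (\sum_k lag_weight p q 0 i j v k * gsc (eps 1 k w))])%E
    @ \oo --> L%:E) /\
  forall t, ('E_P[fun w => (Y t i w ^+ p * Y t j w ^+ q)%R] =
    (level_factor p q i j)%:E *
    'E_P[fun w => (eps 1 i w ^+ p * eps 1 j w ^+ q *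
      expR (\sum_k lag_weight p q 0 i j 0 k * gsc (eps 1 k w)))%R] * L%:E)%E.
Proof.
have eE (X : T -> R) : P.-integrable setT (EFin \o X) ->
    ('E_P[X] = (\int[P]_w X w)%R%:E)%E.
  by move=> iX; rewrite unlock integral_EFin_Rintegral.
pose m := lag_exponent p q 0 i j; pose c := lag_weight p q 0 i j.
pose X0 w := eps 1 i w ^+ p * eps 1 j w ^+ q *
  expR (\sum_k c 0%N k * gsc (eps 1 k w)).
have mS v k : m v.+1 k = 0%N by [].
have [i0 e0] := @Rintegral_block _ _ _ P _ eps indep normal gsc kappa
  measurable_gsc gsc_bound 1 (m 0%N) (c 0%N).
have X0E w : (\prod_k eps 1 k w ^+ m 0%N k) *
    expR (\sum_k c 0%N k * gsc (eps 1 k w)) = X0 w.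
  rewrite /X0 /m /lag_exponent; congr (_ * _).
  under eq_bigr do rewrite exprD.
  have := @prod_indicator_exponent (fun _ k => eps 1 k w) 1 0 j q isT.
  have := @prod_indicator_exponent (fun _ k => eps 1 k w) 1 0 i p isT.
  by rewrite !big_nat1 big_split /= => -> ->.
have iX0 : P.-integrable setT (EFin \o X0).
  by apply: eq_integrable i0 => // w _; rewrite /= X0E.
have eX0 : \int[P]_w X0 w = \prod_k \int[Z]_x monexp gsc (m 0%N k) (c 0%N k) x.
  by rewrite -e0; apply: eq_Rintegral => w _; rewrite X0E.
have [B0 hB0] := lag_bounded p q 0 i j.
have hB1 N : \sum_(0 <= u < N) \sum_k `|c u.+1 k| <= B0.
  apply: le_trans (hB0 N.+1); rewrite [leRHS]big_nat_recl//=.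
  rewrite -[leLHS]add0r lerD//.
    by rewrite sumr_ge0// => k _; rewrite addr_ge0.
  by apply: ler_sum => u _; apply: ler_sum => k _; rewrite lerDr.
have [L L0 limL] := @exists_pos_infinite_prod _ _ _ P _ eps indep normal gsc
  kappa measurable_gsc gsc_bound (fun u k => c u.+1 k) B0 hB1.
split; first exact: iX0.
exists L; split => //; split.
  have -> : (fun N : nat => \prod_(1 <= v < N.+1) 'E_P[fun w =>
      expR (\sum_k lag_weight p q 0 i j v k * gsc (eps 1 k w))])%E =
    (fun N : nat => (\prod_(0 <= u < N) \prod_k
       \int[Z]_x monexp gsc 0 (c u.+1 k) x)%:E).
    apply/funext => N; rewrite big_add1 /= -prodEFin; apply: eq_bigr => u _.
    have [iu eu] := @Rintegral_block _ _ _ P _ eps indep normal gsc kappa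
      measurable_gsc gsc_bound 1 (fun=> 0%N) (c u.+1).
    rewrite -eu -eE//; congr expectation.
    by apply/funext => w; rewrite [X in X * _]big1 ?mul1r.
  exact/cvgn_EFin.
move=> t; have [iF lim] := @moment t 0 i j p q.
rewrite addr0 in iF lim.
rewrite eE// [X in (_ * X * _)%E]eE// -!EFinM; congr (_%:E).
(* The sequence of [moment], with lag 0 separated from the tail; uniqueness of limits then yields
   the formula. *)
have lim' : (fun N => \prod_(0 <= u < N) \prod_k
    \int[Z]_x monexp gsc (m u k) (c u k) x) @ \oo --> \int[P]_w X0 w * L.
  rewrite -cvg_shiftS eX0.
  under eq_fun do rewrite big_nat_recl//.
  by apply: cvgMr; exact: limL.
have e := cvgn_unique lim lim'.
have l0 : level_factor p q i j != 0 by rewrite gt_eqF// expR_gt0.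
by rewrite -mulrA -e mulrA divff// mul1r.
Qed.

(** For [t] and [t'] the same sequence converges to both integrals, up to the same nonzero
    factor. *)
Lemma lagged_product_nonneg (t : int) (h : nat) i j :
  P.-integrable setT (EFin \o (fun w => Y (t + h%:Z) i w * Y t j w)) /\
  forall t', \int[P]_w (Y (t + h%:Z) i w * Y t j w) =
    \int[P]_w (Y (t' + h%:Z) i w * Y t' j w).
Proof.
have IE s : \int[P]_w (Y (s + h%:Z) i w ^+ 1 * Y s j w ^+ 1) =
    \int[P]_w (Y (s + h%:Z) i w * Y s j w).
  by apply: eq_Rintegral => w _; rewrite !expr1.
have [i1 l1] := moment t h i j 1 1.
split; first by apply: eq_integrable i1 => // w _; rewrite /= !expr1.
move=> t'; have [_ l2] := moment t' h i j 1 1.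
have l0 : (level_factor 1 1 i j)^-1 != 0.
  by rewrite invr_eq0 gt_eqF// expR_gt0.
have e := mulfI l0 (cvgn_unique l1 l2).
exact: (etrans (esym (IE t)) (etrans e (IE t'))).
Qed.


Lemma integrable_Ysol_pow t i p :
  P.-integrable setT (EFin \o (fun w => Y t i w ^+ p)).
Proof.
have [i1 _] := moment t 0 i i p 0.
by apply: eq_integrable i1 => // w _; rewrite /= addr0 expr0 mulr1.
Qed.

Lemma expectation_Ysol_stationary t i :
  ('E_P[Y t i] = 'E_P[Y 0 i])%E.
Proof.
have E s : Y s i = (fun w => Y s i w ^+ 1 * Y s i w ^+ 0).
  by apply/funext => w; rewrite expr0 mulr1.
have [_ [L [_ [_ eL]]]] := moment_formula i i 1 0.
have e s : ('E_P[Y s i] = 'E_P[fun w => (Y s i w ^+ 1 * Y s i w ^+ 0)%R])%E.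
  by congr expectation.
exact: (etrans (e t) (etrans (etrans (eL t) (esym (eL 0))) (esym (e 0)))).
Qed.

Lemma weakly_stationary_Ysol : weakly_stationary P Y.
Proof.
apply: weakly_stationary_of_moments.
- exact: integrable_Ysol_pow.
- exact: expectation_Ysol_stationary.
- by move=> t h i j; exact: (lagged_product_nonneg t h i j).1.
- by move=> t t' h i j; exact: (lagged_product_nonneg t h i j).2.
Qed.

Lemma lag_weight_sum p q i j v t w :
  \sum_k lag_weight p q 0 i j v k * gsc (eps t k w) =
  p%:R / 2 * (lag_coef v *m G t w) i 0 + q%:R / 2 * (lag_coef v *m G t w) j 0.
Proof.
rewrite !mxE !mulr_sumr -big_split; apply: eq_bigr => k _.
by rewrite g_atE /lag_weight leq0n subn0 mulrDl !mulrA.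
Qed.

End LogVolatility.

(** * The moment formulas in terms of [A] and [M] *)

Lemma unitv_trmx_mul {R : realType} {n : nat} (i : 'I_n) (X : 'cV[R]_n) :
  ((unitv i)^T *m X) 0 0 = X i 0.
Proof. by rewrite /unitv trmx_delta -rowE mxE. Qed.

Theorem theorem1 (d : measure_display) (T : measurableType d) (R : realType)
  (P : probability T R) (n : nat) (W1 W2 : 'M[R]_n) (alpha1 : 'cV[R]_n)
  (rho0 rho1 lambda0 lambda1 Theta xi : R) (eps : int -> 'I_n -> T -> R) :
  (0 < n)%N -> 0 <= xi -> `|Theta| < xi ->
  (1%:M - lambda0 *: W2) \in unitmx ->
  let S := invmx (1%:M - lambda0 *: W2) in
  spectral_radius (lambda1 *: S) < 1 ->
  spectral_radius (lambda0 *: W2) < 1 ->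
  mutually_independent P (fun k : int * 'I_n => eps k.1 k.2) ->
  (forall t i, std_normal P (eps t i)) ->
  let Y := Ysol P S W1 alpha1 rho0 rho1 lambda1 Theta xi eps in
  let M := (rho0 * lambda1) *: (S *m W1) + rho1 *: 1%:M in
  let A := invmx ((1 - lambda1) *: 1%:M - lambda0 *: W2) in
  let g1 := g_at P Theta xi eps 1 in
  (* the series defining the solution converges almost surely *)
  (forall t i, {ae P, forall w,
     cvgn (series (Yterm P S W1 alpha1 rho0 rho1 lambda1 Theta xi eps t i w))}) /\
  (* finite moments of all orders *)
  (forall t i (p : nat), P.-integrable setT (fun w => (`|Y t i w| ^+ p)%:E)) /\
  (* weak stationarity *)
  weakly_stationary P Y /\
  (* first moment *)
  (forall (t : int) (i : 'I_n),
     P.-integrable setT (fun w =>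
       (eps 1 i w * expR (2^-1 * (rho0 * ((unitv i)^T *m S *m W1 *m g1 w) ord0 ord0)))%:E) /\
     exists L : R, 0 < L /\
       ((fun N : nat => (\prod_(1 <= v < N.+1)
          'E_P[fun w => (expR (2^-1 * (lambda1 ^+ v.-1 *
                 ((unitv i)^T *m S ^+ v *m M *m g1 w) ord0 ord0)))%R])%E) @ \oo --> L%:E) /\
       ('E_P[Y t i] =
          (expR (2^-1 * ((unitv i)^T *m A *m alpha1) ord0 ord0)%R)%:E *
          'E_P[fun w => (eps 1 i w *
                 expR (2^-1 * (rho0 * ((unitv i)^T *m S *m W1 *m g1 w) ord0 ord0)))%R] *
          L%:E)%E) /\
  (* second moment *)
  (forall (t : int) (i : 'I_n),
     P.-integrable setT (fun w =>
       (eps 1 i w ^+ 2 * expR (rho0 * ((unitv i)^T *m S *m W1 *m g1 w) ord0 ord0))%:E) /\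
     exists L : R, 0 < L /\
       ((fun N : nat => (\prod_(1 <= v < N.+1)
          'E_P[fun w => (expR (lambda1 ^+ v.-1 *
                 ((unitv i)^T *m S ^+ v *m M *m g1 w) ord0 ord0))%R])%E) @ \oo --> L%:E) /\
       ('E_P[fun w => (Y t i w ^+ 2)%R] =
          (expR (((unitv i)^T *m A *m alpha1) ord0 ord0)%R)%:E *
          'E_P[fun w => (eps 1 i w ^+ 2 *
                 expR (rho0 * ((unitv i)^T *m S *m W1 *m g1 w) ord0 ord0))%R] *
          L%:E)%E) /\
  (* cross moment *)
  (forall (t : int) (i j : 'I_n),
     P.-integrable setT (fun w =>
       (eps 1 i w * eps 1 j w * expR (2^-1 *
          (rho0 * ((unitv i + unitv j)^T *m S *m W1 *m g1 w) ord0 ord0)))%:E) /\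
     exists L : R, 0 < L /\
       ((fun N : nat => (\prod_(1 <= v < N.+1)
          'E_P[fun w => (expR (2^-1 * (lambda1 ^+ v.-1 *
                 ((unitv i + unitv j)^T *m S ^+ v *m M *m g1 w) ord0 ord0)))%R])%E)
          @ \oo --> L%:E) /\
       ('E_P[fun w => (Y t i w * Y t j w)%R] =
          (expR (2^-1 * ((unitv i + unitv j)^T *m A *m alpha1) ord0 ord0)%R)%:E *
          'E_P[fun w => (eps 1 i w * eps 1 j w *
                 expR (2^-1 * (rho0 * ((unitv i + unitv j)^T *m S *m W1 *m g1 w) ord0 ord0)))%R] *
          L%:E)%E).
Proof.
move=> n0 xi0 Txi uV S rS _ indep normal Y M A g1.
have [C [r [C0 r0 r1 Sr]]] := spectral_radius_mx_pow_bound _ _ rS.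
(* [K] is the inverse of [S] minus [lambda1] times the identity, and [A] is its inverse. *)
pose K := (1 - lambda1) *: 1%:M - lambda0 *: W2.
have SK : S *m K = 1%:M - lambda1 *: S.
  have -> : K = (1%:M - lambda0 *: W2) - lambda1 *: 1%:M.
    by rewrite /K scalerBl scale1r addrAC.
  by rewrite mulmxBr mulVmx// -scalemxAr mulmx1.
have mf := @moment_formula _ _ _ P n eps indep normal S W1 K alpha1 rho0 rho1
  lambda1 Theta xi SK C r C0 r0 r1 Sr.
pose q v w k := (lag_coef S W1 rho0 rho1 lambda1 v *m g1 w) k 0.
have qE p p' i j v w : \sum_k lag_weight S W1 rho0 rho1 lambda1 p p' 0 i j v k *
    gsc Theta xi (eps 1 k w) = p%:R / 2 * q v w i + p'%:R / 2 * q v w j.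
  exact: lag_weight_sum.
have uD i j (X : 'cV[R]_n) :
    ((unitv i + unitv j)^T *m X) 0 0 = X i 0 + X j 0.
  by rewrite linearD mulmxDl mxE !unitv_trmx_mul.
have q0 w k : rho0 * (S *m (W1 *m g1 w)) k 0 = q 0%N w k.
  by rewrite /q /lag_coef -scalemxAl [in RHS]mxE mulmxA.
have qS v w k : (0 < v)%N ->
    lambda1 ^+ v.-1 * (S ^+ v *m (M *m g1 w)) k 0 = q v w k.
  by case: v => // v _; rewrite /q /lag_coef -scalemxAl [in RHS]mxE mulmxA.
split.
  move=> t i.
  have := @ae_cvg_log_volatility _ _ _ P n eps indep normal S W1 K alpha1 rho0
    rho1 lambda1 Theta xi SK C r C0 r0 r1 Sr t i.
  by apply: filterS => w [].
split.
  move=> t i p.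
  have := integrable_norm (@integrable_Ysol_pow _ _ _ P n eps indep normal S W1 K
    alpha1 rho0 rho1 lambda1 Theta xi SK C r C0 r0 r1 Sr t i p).
  by apply: eq_integrable => // w _; rewrite /= normrX.
split.
  exact: (@weakly_stationary_Ysol _ _ _ P n eps indep normal S W1 K
    alpha1 rho0 rho1 lambda1 Theta xi SK C r C0 r0 r1 Sr).
split.
  (* The second exponent 0 removes the second component, so [i] fills its place; the weight [p / 2]
     gives the factor 1/2 here and 1 in the second moment. *)
  move=> t i; have [I1 [L [L0 [lim eL]]]] := mf i i 1%N 0%N.
  have X0 : (fun w => eps 1 i w * expR (2^-1 *
      (rho0 * ((unitv i)^T *m S *m W1 *m g1 w) ord0 ord0))) =
    (fun w => eps 1 i w ^+ 1 * eps 1 i w ^+ 0 * expR (\sum_k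
      lag_weight S W1 rho0 rho1 lambda1 1 0 0 i i 0 k *
      gsc Theta xi (eps 1 k w))).
    apply/funext => w; rewrite qE -!mulmxA unitv_trmx_mul q0 expr0 mulr1.
    by congr (_ * expR _); ring.
  split; first by under eq_fun do rewrite (congr1 (fun f => f _) X0).
  exists L; split => //; split.
    apply: cvg_trans lim; apply: near_eq_cvg; apply: nearW => N.
    apply: eq_big_nat => v /andP[v1 _]; congr expectation; apply/funext => w.
    by rewrite qE -!mulmxA unitv_trmx_mul qS//; congr expR; ring.
  apply: etrans (etrans (eL t) _).
    by congr expectation; apply/funext => w; rewrite expr0 mulr1.
  congr (_%:E * _ * _)%E; last by congr expectation; exact: (esym X0).
  rewrite /level_factor -!mulmxA unitv_trmx_mul.
  by congr expR; rewrite /A -/K; ring.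
split.
  move=> t i; have [I1 [L [L0 [lim eL]]]] := mf i i 2%N 0%N.
  have X0 : (fun w => eps 1 i w ^+ 2 * expR
      (rho0 * ((unitv i)^T *m S *m W1 *m g1 w) ord0 ord0)) =
    (fun w => eps 1 i w ^+ 2 * eps 1 i w ^+ 0 * expR (\sum_k
      lag_weight S W1 rho0 rho1 lambda1 2 0 0 i i 0 k *
      gsc Theta xi (eps 1 k w))).
    apply/funext => w; rewrite qE -!mulmxA unitv_trmx_mul q0 expr0 mulr1.
    by congr (_ * expR _); field.
  split; first by under eq_fun do rewrite (congr1 (fun f => f _) X0).
  exists L; split => //; split.
    apply: cvg_trans lim; apply: near_eq_cvg; apply: nearW => N.
    apply: eq_big_nat => v /andP[v1 _]; congr expectation; apply/funext => w.
    by rewrite qE -!mulmxA unitv_trmx_mul qS//; congr expR; field.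
  apply: etrans (etrans (eL t) _).
    by congr expectation; apply/funext => w; rewrite expr0 mulr1.
  congr (_%:E * _ * _)%E; last by congr expectation; exact: (esym X0).
  rewrite /level_factor -!mulmxA unitv_trmx_mul.
  by congr expR; rewrite /A -/K; field.
move=> t i j; have [I1 [L [L0 [lim eL]]]] := mf i j 1%N 1%N.
have X0 : (fun w => eps 1 i w * eps 1 j w * expR (2^-1 *
    (rho0 * ((unitv i + unitv j)^T *m S *m W1 *m g1 w) ord0 ord0))) =
  (fun w => eps 1 i w ^+ 1 * eps 1 j w ^+ 1 * expR (\sum_k
    lag_weight S W1 rho0 rho1 lambda1 1 1 0 i j 0 k *
    gsc Theta xi (eps 1 k w))).
  apply/funext => w; rewrite qE -!mulmxA uD mulrDr !q0.
  by congr (_ * expR _); ring.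
split; first by under eq_fun do rewrite (congr1 (fun f => f _) X0).
exists L; split => //; split.
  apply: cvg_trans lim; apply: near_eq_cvg; apply: nearW => N.
  apply: eq_big_nat => v /andP[v1 _]; congr expectation; apply/funext => w.
  by rewrite qE -!mulmxA uD mulrDr !qS//; congr expR; ring.
apply: etrans (etrans (eL t) _); first by [].
congr (_%:E * _ * _)%E; last by congr expectation; exact: (esym X0).
rewrite /level_factor -!mulmxA uD.
by congr expR; rewrite /A -/K; ring.
Qed.
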